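(* Let $\lambda$ be a shape. The (geometric) shard intersection order $\Psi^f(\lambda)$ is a graded lattice.
   Context: A shape is a finite vertex-induced subgraph $\lambda$ of the square grid $\mathbb{Z}^2$ (two points are adjacent iff they differ by 1 in exactly one coordinate and agree in the other). $(a,b)$ is immediately South of $(a,b+1)$ and immediately East of $(a-1,b)$; North and West are the reverse relations. A vertex of $\lambda$ is interior if all four of its grid neighbors are in $\lambda$, and a boundary vertex otherwise; $V^o$ is the set of interior vertices. A (boundary) path is a sequence of vertices $(v_0,\ldots,v_l)$ of $\lambda$, $l>0$, with $v_0,v_l$ boundary vertices, $v_1,\dots,v_{l-1}$ interior vertices, and each $v_i$ immediately South or East of $v_{i-1}$. A segment is a sequence of interior vertices $(v_0,\ldots,v_l)$, $l\ge 0$, with each $v_i$ immediately South or East of $v_{i-1}$; $\mathrm{Seg}(\lambda)$ is the set of segments. If $t=(v_i,\dots,v_j)$ is a segment contained in a path $p=(v_0,\dots,v_l)$, then $p$ enters $t$ from the West (resp. North) if $v_{i-1}$ is immediately West (resp. North) of $v_i$, and leaves $t$ to the East (resp. South) if $v_{j+1}$ is immediately East (resp. South) of $v_j$. The same language is used for a single interior vertex $t=(v)$; $p$ turns at $v$ if it enters $v$ from the North and leaves to the East or enters $v$ from the West and leaves to the South. Two paths $p,q$ kiss along a common segment $s$ if (up to exchanging $p$ and $q$) $p$ enters $s$ from the West and leaves $s$ to the South, while $q$ enters $s$ from the North and leaves $s$ to the East; otherwise (for all $s$) they are nonkissing. The reduced nonkissing complex $\widetilde\Delta^{NK}(\lambda)$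 is the simplicial complex whose faces are the sets (including $\emptyset$) of pairwise nonkissing paths, none of which is horizontal (only East steps) or vertical (only South steps). For a path $p$, $g_p\in\mathbb{R}^{V^o}$ has $g_p(v)=1$ if $p$ enters $v$ from the North and leaves to the East, $g_p(v)=-1$ if $p$ enters $v$ from the West and leaves to the South, and $g_p(v)=0$ otherwise. For a face $F$ of $\widetilde\Delta^{NK}(\lambda)$, $C(F)$ is the cone generated by $\{g_p:p\in F\}$. For a segment $s$, $\Delta_s$ is the set of faces $F$ of $\widetilde\Delta^{NK}(\lambda)$ such that for all $p\in F$ and every maximal subsegment $t$ of $s$ contained in $p$, $p$ turns at an even number of vertices of $t$. The shard of $s$ is $\Sigma(s)=\bigcup_{F\in\Delta_s}C(F)\subseteq\mathbb{R}^{V^o}$. The shard intersection order $\Psi^f(\lambda)$ is the poset of all intersections $\bigcap_{s\in I}\Sigma(s)$, $I\subseteq\mathrm{Seg}(\lambda)$ (the empty intersection being $\mathbb{R}^{V^o}$), ordered by reverse inclusion. A finite poset with minimum and maximum is graded if all its maximal chains have the same length. *)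

(* Defs.v *)
From HB Require Import structures.
From mathcomp Require Import all_boot all_order all_algebra.
From mathcomp Require Import finmap.
From mathcomp Require Import boolp classical_sets cardinality reals.

Import Order.TTheory GRing.Theory Num.Theory.

Local Open Scope fset_scope.
Local Open Scope classical_set_scope.
Local Open Scope card_scope.
Local Open Scope ring_scope.

Definition vertex : Type := (int * int)%type.

Definition north (v : vertex) : vertex := (v.1, v.2 + 1).
Definition south (v : vertex) : vertex := (v.1, v.2 - 1).
Definition east (v : vertex) : vertex := (v.1 + 1, v.2).
Definition west (v : vertex) : vertex := (v.1 - 1, v.2).

(* A shape is given by its finite vertex set lam : {fset vertex}; its edges,
   being those induced by the grid, carry no further data. *)

Definition interior_vertex (lam : {fset vertex}) (v : vertex) : bool :=
  [&& v \in lam, north v \in lam, south v \in lam, east v \in lam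
    & west v \in lam].

Definition boundary_vertex (lam : {fset vertex}) (v : vertex) : bool :=
  (v \in lam) && ~~ interior_vertex lam v.

Definition interior_set (lam : {fset vertex}) : {fset vertex} :=
  [fset v in lam | interior_vertex lam v]%fset.

Definition step (u v : vertex) : bool := (v == south u) || (v == east u).

Definition is_path (lam : {fset vertex}) (p : seq vertex) : bool :=
  if p is v :: t then
    [&& t != [::], path step v t, boundary_vertex lam v,
        boundary_vertex lam (last v t)
      & all (interior_vertex lam) (behead (belast v t))]
  else false.

Definition is_segment (lam : {fset vertex}) (s : seq vertex) : bool :=
  [&& s != [::], all (interior_vertex lam) s & sorted step s].

(* Along a path or a segment the first coordinate minus the second increases
   by one at each step, so vertices do not repeat and a nonempty sequence occurs
   at most once as a contiguous subsequence (infix).  Hence t is contained in p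
   iff [infix t p], and the vertex of p that precedes (follows) t is the one
   which, added in front of (behind) t, still gives an infix of p. *)

Definition enters_west (p t : seq vertex) : bool :=
  if t is v :: _ then infix (west v :: t) p else false.

Definition enters_north (p t : seq vertex) : bool :=
  if t is v :: _ then infix (north v :: t) p else false.

Definition leaves_east (p t : seq vertex) : bool :=
  if t is v :: t' then infix (rcons t (east (last v t'))) p else false.

Definition leaves_south (p t : seq vertex) : bool :=
  if t is v :: t' then infix (rcons t (south (last v t'))) p else false.

Definition turns (p : seq vertex) (v : vertex) : bool :=
  (enters_north p [:: v] && leaves_east p [:: v])
  || (enters_west p [:: v] && leaves_south p [:: v]).

Definition kiss_along (lam : {fset vertex}) (p q s : seq vertex) : Prop :=
  is_segment lam s /\
  ([/\ enters_west p s, leaves_south p s, enters_north q s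
     & leaves_east q s] \/
   [/\ enters_west q s, leaves_south q s, enters_north p s
     & leaves_east p s]).

Definition nonkissing (lam : {fset vertex}) (p q : seq vertex) : Prop :=
  forall s : seq vertex, ~ kiss_along lam p q s.

Definition horizontal (p : seq vertex) : bool :=
  sorted (fun u v => v == east u) p.

Definition vertical (p : seq vertex) : bool :=
  sorted (fun u v => v == south u) p.

Definition reduced_nonkissing_complex (lam : {fset vertex}) :
    set {fset seq vertex} :=
  [set F | (forall p, p \in F ->
              [/\ is_path lam p, ~~ horizontal p & ~~ vertical p]) /\
           (forall p q, p \in F -> q \in F -> nonkissing lam p q)].

Definition gvector (R : realType) (lam : {fset vertex}) (p : seq vertex) :
    {ffun interior_set lam -> R} :=
  [ffun v =>
    if enters_north p [:: val v] && leaves_east p [:: val v] then 1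
    else if enters_west p [:: val v] && leaves_south p [:: val v] then -1
    else 0].

Definition cone (R : realType) (lam : {fset vertex}) (F : {fset seq vertex}) :
    set {ffun interior_set lam -> R} :=
  [set x | exists c : seq vertex -> R,
     (forall p, p \in F -> 0 <= c p) /\
     forall v, x v = \sum_(p <- F) c p * gvector R lam p v].

Definition maximal_common_subsegment (s p t : seq vertex) : Prop :=
  [/\ t != [::], infix t s, infix t p
    & forall t', infix t' s -> infix t' p -> infix t t' -> t' = t].

Definition shard_complex (lam : {fset vertex}) (s : seq vertex) :
    set {fset seq vertex} :=
  [set F | reduced_nonkissing_complex lam F /\
     forall p t, p \in F -> maximal_common_subsegment s p t ->
       ~~ odd (count (turns p) t)].

Definition shard (R : realType) (lam : {fset vertex}) (s : seq vertex) :
    set {ffun interior_set lam -> R} :=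
  \bigcup_(F in shard_complex lam s) cone R lam F.

Definition shard_intersections (R : realType) (lam : {fset vertex}) :
    set (set {ffun interior_set lam -> R}) :=
  [set X | exists2 I : set (seq vertex),
     I `<=` [set s | is_segment lam s] & X = \bigcap_(s in I) shard R lam s].

Definition shard_order (R : realType) (lam : {fset vertex}) : Type :=
  {X : set {ffun interior_set lam -> R} | X \in shard_intersections R lam}.

HB.instance Definition _ (R : realType) (lam : {fset vertex}) :=
  Choice.on (shard_order R lam).

Fact shard_display : Order.disp_t. Proof. exact: Order.Disp tt tt. Qed.

Section ShardOrder.
Variables (R : realType) (lam : {fset vertex}).

Definition shard_le (X Y : shard_order R lam) : bool :=
  `[< val Y `<=` val X >].

Fact shard_le_refl : reflexive shard_le.
Proof. by move=> X; apply/asboolP. Qed.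

Fact shard_le_anti : antisymmetric shard_le.
Proof.
move=> X Y /andP[/asboolP YX /asboolP XY].
by apply/val_inj/seteqP; split.
Qed.

Fact shard_le_trans : transitive shard_le.
Proof.
move=> Y X Z /asboolP YX /asboolP ZY; apply/asboolP.
exact: subset_trans YX.
Qed.

HB.instance Definition _ := Order.Le_isPOrder.Build shard_display
  (shard_order R lam) shard_le_refl shard_le_anti shard_le_trans.

End ShardOrder.

Section Posets.
Context {d : Order.disp_t}.
Variable T : porderType d.

Definition is_lattice : Prop :=
  forall x y : T,
    (exists m : T, [/\ (m <= x)%O, (m <= y)%O
       & forall z : T, (z <= x)%O -> (z <= y)%O -> (z <= m)%O]) /\
    (exists j : T, [/\ (x <= j)%O, (y <= j)%O
       & forall z : T, (x <= z)%O -> (y <= z)%O -> (j <= z)%O]).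

Definition chain (C : set T) : Prop := total_on C (fun x y => (x <= y)%O).

Definition maximal_chain (C : set T) : Prop :=
  chain C /\ forall D : set T, chain D -> C `<=` D -> D = C.

(* The length of a finite nonempty chain is its cardinality minus one, so having
   the same length means being equipotent. *)
Definition is_graded : Prop :=
  [/\ finite_set [set: T],
      exists b : T, forall x : T, (b <= x)%O,
      exists t : T, forall x : T, (x <= t)%O
    & forall C D : set T, maximal_chain C -> maximal_chain D -> C #= D].

End Posets.

(* Main.v *)
Require Import Defs.
From mathcomp Require Import all_boot all_order all_algebra.
From mathcomp Require Import finmap reals.
From mathcomp Require Import boolp classical_sets cardinality.
From mathcomp Require Import zify lra.

(** The [g]-vector fan gives each shard an inequality description: [x] lies in
    the shard of [s] iff the sum of [x] over [s] vanishes and every proper prefix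
    sum of [x] along [s] is nonnegative before an East step and nonpositive before
    a South step ("[s] is [x]-semistable").  The key is that every [x] is a
    nonnegative combination of [g]-vectors of the paths [p] on which each
    subsegment entered from the North and left to the East has positive [x]-sum,
    and each one entered from the West and left to the South negative [x]-sum;
    such paths are automatically pairwise nonkissing.

    Let [W x] be the set of [x]-semistable segments.  Cutting a segment of [W x]
    at its zero prefix sums decomposes it into stable segments, and distinct
    stable segments have distinct first vertices and distinct last vertices; so
    their indicator vectors are linearly independent, and for nested
    [W y `<=` W x] the numbers of stable segments are ordered, with equality only
    if [W y = W x].  Every intersection of shards is [{y | W x `<=` W y}] for an
    [x] in it with fewest stable segments, and for [W x' < W x] a perturbation
    argument yields an intermediate [W g] having exactly one stable segment less
    than [W x].  Hence the number of stable segments is a rank function.  The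
    lattice property holds because the intersections of shards are closed under
    intersection. *)

Set Implicit Arguments.
Unset Strict Implicit.
Unset Printing Implicit Defensive.

Import Order.TTheory GRing.Theory Num.Theory.
Local Open Scope ring_scope.

(** * Contiguous subsequences of lists without repetitions *)

Section Lists.
Context {T : eqType}.
Implicit Types (p a b c s t u : seq T) (v w x : T).

Lemma cat_eq_cat s t a b : s ++ t = a ++ b ->
  (exists m, a = s ++ m /\ t = m ++ b) \/ (exists m, s = a ++ m /\ b = m ++ t).
Proof.
elim: s a => [|x s IH] [|y a] /= E.
- by left; exists [::].
- by left; exists (y :: a).
- by right; exists (x :: s); rewrite -E.
case: E => <- /IH [[m [-> ->]]|[m [-> ->]]]; first by left; exists m.
by right; exists m.
Qed.

Lemma uniq_cat_inj v a b a' b' :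
  uniq (a ++ v :: b) -> a ++ v :: b = a' ++ v :: b' -> a = a' /\ b = b'.
Proof.
elim: a a' => [|x a IH] [|y a'] //=.
- by move=> _ [->].
- by case/andP=> vb _ [E1 E2]; move: vb; rewrite E2 mem_cat inE -E1 eqxx orbT.
- by case/andP=> xa _ [E1 E2]; move: xa; rewrite E1 mem_cat inE eqxx orbT.
by case/andP=> _ U [-> /(IH _ U)[-> ->]].
Qed.

(** In a list without repetitions [v] has a single position, so the two occurrences overlap
    there. *)
Lemma infix_glue p v a b : uniq p ->
  infix (rcons a v) p -> infix (v :: b) p -> infix (a ++ v :: b) p.
Proof.
move=> U /infixP[x [y E1]] /infixP[x' [y' E2]]; apply/infixP.
have E : (x ++ a) ++ v :: y = x' ++ v :: (b ++ y').
  by rewrite -E2 E1 -cats1 -!catA.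
have [|E3 E4] := uniq_cat_inj _ E; first by rewrite -catA -cat_rcons -E1.
by exists x, y'; rewrite E1 -cats1 -!catA /= E4.
Qed.

Lemma infix_pred_inj p v w w' : uniq p ->
  infix [:: w; v] p -> infix [:: w'; v] p -> w = w'.
Proof.
move=> U /infixP[x [y E1]] /infixP[x' [y' E2]].
have E : (x ++ [:: w]) ++ v :: y = (x' ++ [:: w']) ++ v :: y'.
  by rewrite -!catA /= -E1 -E2.
have [|E3 _] := uniq_cat_inj _ E; first by rewrite -catA /= -E1.
by move: E3; rewrite !cats1 => /rcons_inj[].
Qed.

Lemma infix_succ_inj p v w w' : uniq p ->
  infix [:: v; w] p -> infix [:: v; w'] p -> w = w'.
Proof.
move=> U /infixP[x [y E1]] /infixP[x' [y' E2]].
have E : x ++ v :: (w :: y) = x' ++ v :: (w' :: y') by rewrite -E1 -E2.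
have [|_ []//] := uniq_cat_inj _ E; by rewrite -E1.
Qed.

Lemma infix3l x v w p : infix [:: x; v; w] p -> infix [:: x; v] p.
Proof. exact: (@catr_infix _ [:: w] [:: x; v]). Qed.

Lemma infix3r x v w p : infix [:: x; v; w] p -> infix [:: v; w] p.
Proof. exact: (@catl_infix _ [:: x]). Qed.

Lemma common_prefix s t : exists c a b, [/\ s = c ++ a, t = c ++ b &
  forall x a' y b', a = x :: a' -> b = y :: b' -> x != y].
Proof.
elim: s t => [|x s IH] [|y t].
- by exists [::], [::], [::].
- by exists [::], [::], (y :: t).
- by exists [::], (x :: s), [::].
have [<-|ne] := eqVneq x y.
  have [c [a [b [-> -> H]]]] := IH t; by exists (x :: c), a, b.
by exists [::], (x :: s), (y :: t); split=> // ? ? ? ? [<- _] [<- _].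
Qed.

Lemma seq_argmin (R : realDomainType) (l : seq T) (phi : T -> R) : l != [::] ->
  exists2 x, x \in l & forall y, y \in l -> phi x <= phi y.
Proof.
elim: l => // x [|x' l] IH _.
  by exists x; rewrite ?mem_head// => y; rewrite inE => /eqP->.
have [//|z zl Hz] := IH.
have [le|lt] := lerP (phi x) (phi z).
  exists x; rewrite ?mem_head// => y; rewrite inE => /predU1P[->//|/Hz].
  exact: le_trans.
exists z; first by rewrite inE zl orbT.
by move=> y; rewrite inE => /predU1P[->|/Hz//]; exact: ltW.
Qed.

End Lists.

(** * Steps and levels in the grid *)

Section Vertices.
Implicit Types (u v w : vertex) (d : bool).

(* [true] is the direction East, [false] the direction South. *)
Definition nx d v : vertex := if d then east v else south v.
Definition pv d v : vertex := if d then west v else north v.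
Definition lev v : int := v.1 - v.2.

Lemma nx_pv d v : nx d (pv d v) = v.
Proof.
by case: d v => -[x y]; rewrite /nx /pv /east /west /north /south /= ?subrK ?addrK.
Qed.

Lemma pv_nx d v : pv d (nx d v) = v.
Proof.
by case: d v => -[x y]; rewrite /nx /pv /east /west /north /south /= ?subrK ?addrK.
Qed.

Lemma nx_inj d d' v : nx d v = nx d' v -> d = d'.
Proof. by case: d; case: d' => //; case: v => x y [] /=; lia. Qed.

Lemma pv_inj d d' v : pv d v = pv d' v -> d = d'.
Proof. by case: d; case: d' => //; case: v => x y [] /=; lia. Qed.

Lemma eq_nx d d' v : (nx d v == nx d' v) = (d == d').
Proof. by apply/eqP/eqP => [/nx_inj|->]. Qed.

Lemma stepP u v : reflect (exists d, v = nx d u) (step u v).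
Proof.
apply: (iffP orP) => [[]/eqP->|[[] ->]]; [by exists false|by exists true|..].
  by right.
by left.
Qed.

Lemma step_nx d u : step u (nx d u). Proof. by apply/stepP; exists d. Qed.
Lemma step_pv d u : step (pv d u) u. Proof. by apply/stepP; exists d; rewrite nx_pv. Qed.

Lemma step_pvP u v : step u v -> exists d, u = pv d v.
Proof. by case/stepP=> d ->; exists d; rewrite pv_nx. Qed.

Lemma lev_step u v : step u v -> lev v = lev u + 1.
Proof. by case/stepP=> -[] ->; rewrite /lev /nx /=; lia. Qed.

Lemma lev_lt v s w : path step v s -> w \in s -> lev v < lev w.
Proof.
elim: s v => //= x s IH v /andP[/lev_step E P]; rewrite inE => /predU1P[->|/(IH _ P)]; lia.
Qed.

Lemma path_step_uniq v s : path step v s -> uniq (v :: s).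
Proof.
elim: s v => //= x s IH v /andP[st P]; have := IH _ P => /= ->; rewrite andbT.
by apply/negP => /(lev_lt (v:=v) (s:=x::s) _); rewrite /= st P ltxx => /(_ isT).
Qed.

Lemma sorted_step_uniq s : sorted step s -> uniq s.
Proof. by case: s => //= v s /path_step_uniq. Qed.

Lemma sorted_infix s t : sorted step s -> infix t s -> sorted step t.
Proof. by move=> S /infixP[x [y E]]; move: S; rewrite E => /cat_sorted2[_ /cat_sorted2[]]. Qed.

End Vertices.

(** * Paths and g-vectors *)

Section PathFacts.
Variables (lam : {fset vertex}) (p : seq vertex).
Hypothesis Pp : is_path lam p.

Lemma is_path_sorted : sorted step p.
Proof. by case: p Pp => // v t /and5P[]. Qed.

Lemma is_path_uniq : uniq p.
Proof. exact/sorted_step_uniq/is_path_sorted. Qed.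

Lemma is_path_inner1 a u b : p = a ++ u :: b -> a != [::] -> b != [::] ->
  interior_vertex lam u.
Proof.
case: a => // v0 a; case: b => // z b E _ _; move: Pp; rewrite E /=.
case/and5P=> _ _ _ _ /allP; apply; rewrite belast_cat /=.
by case: a {E} => [|x a] /=; rewrite ?mem_cat !inE eqxx ?orbT.
Qed.

Lemma is_path_inner w t z : infix (w :: t ++ [:: z]) p ->
  all (interior_vertex lam) t.
Proof.
move=> /infixP[x [y E]]; apply/allP => u ut; move: E; case/path.splitPr: ut => t1 t2 E.
apply: (@is_path_inner1 (x ++ w :: t1) u (t2 ++ z :: y)).
- rewrite E /= -!catA /=. by rewrite -?catA.
- by case: (x).
- by case: (t2).
Qed.

(** The ends of a path are boundary vertices, so an interior vertex has both a predecessor and a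
    successor on it. *)
Lemma path_interior_mem v : interior_vertex lam v -> v \in p ->
  exists d1 d2, infix [:: pv d1 v; v; nx d2 v] p.
Proof.
move=> iv vp; move: Pp is_path_sorted; case/path.splitPr: vp => a b P S.
have nbv : boundary_vertex lam v = false by rewrite /boundary_vertex iv andbF.
have [a' [w Ea]] : exists a' w, a = rcons a' w.
  case/lastP: a P {S} => [|a' w _]; last by exists a', w.
  by rewrite /is_path /= nbv !andbF.
have [z [b' Eb]] : exists z b', b = z :: b'.
  case: b P {S} => [|z b' _]; last by exists z, b'.
  by rewrite Ea; case: a' {Ea} => [|v0 a']; rewrite /is_path /= ?last_rcons ?cats1 ?last_rcons nbv !andbF.
subst a b; move: S; rewrite cat_rcons => /cat_sorted2[_] /= /and3P[/step_pvP[d1 ->] /stepP[d2 ->] _].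
by exists d1, d2; apply/infixP; exists a', b'.
Qed.

End PathFacts.

Section Sums.
Context {R : realType}.
Implicit Types (f : vertex -> R) (s t : seq vertex) (d : bool).

Definition sm f s : R := \sum_(v <- s) f v.

Lemma sm_nil f : sm f [::] = 0. Proof. exact: big_nil. Qed.
Lemma sm_cons f v s : sm f (v :: s) = f v + sm f s. Proof. exact: big_cons. Qed.
Lemma sm_cat f s t : sm f (s ++ t) = sm f s + sm f t. Proof. exact: big_cat. Qed.
Lemma sm_rcons f s v : sm f (rcons s v) = sm f s + f v.
Proof. by rewrite -cats1 sm_cat sm_cons sm_nil addr0. Qed.

Lemma eq_sm f f' s : {in s, f =1 f'} -> sm f s = sm f' s.
Proof. by move=> E; rewrite /sm big_seq [RHS]big_seq; apply: eq_bigr => v /E. Qed.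

Lemma smD f f' (r : R) s : sm (fun v => f v + r * f' v) s = sm f s + r * sm f' s.
Proof. by rewrite /sm big_split /= mulr_sumr. Qed.

Definition dsign d : R := if d then 1 else -1.

Lemma dsignN d : dsign (~~ d) = - dsign d. Proof. by case: d; rewrite /dsign ?opprK. Qed.

Lemma dsign_gt0_inj d d' (r : R) : 0 < dsign d * r -> 0 < dsign d' * r -> d = d'.
Proof. by case: d; case: d'; rewrite /dsign // !mul1r !mulN1r oppr_gt0 => h1 /(lt_trans h1); rewrite ltxx. Qed.

End Sums.

Section GVector.
Variables (R : realType) (lam : {fset vertex}) (p : seq vertex).
Hypothesis Pp : is_path lam p.
Implicit Types (s t u : seq vertex) (v c w : vertex) (d : bool).

Definition gv v : R :=
  if enters_north p [:: v] && leaves_east p [:: v] then 1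
  else if enters_west p [:: v] && leaves_south p [:: v] then -1 else 0.

Let U : uniq p := is_path_uniq Pp.

Lemma infix_turnE d1 d2 v d : infix [:: pv d1 v; v; nx d2 v] p ->
  (infix [:: v; nx d v] p = (d == d2)) * (infix [:: pv d v; v] p = (d == d1)).
Proof.
move=> H.
have I1 : infix [:: pv d1 v; v] p by exact: infix3l H.
have I2 : infix [:: v; nx d2 v] p by exact: infix3r H.
split; apply/idP/eqP => [H'|-> //].
  exact: nx_inj (infix_succ_inj U H' I2).
exact: pv_inj (infix_pred_inj U H' I1).
Qed.

(** The signed value is the change of the indicator of heading in direction [d]; this is what makes
    sums along a run telescope. *)
Lemma gv_turnE d1 d2 v d : infix [:: pv d1 v; v; nx d2 v] p ->
  dsign d * gv v = (d == d2)%:R - (d == d1)%:R.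
Proof.
move=> H; rewrite /gv /enters_north /enters_west /leaves_east /leaves_south /=.
have E d' := infix_turnE d' H.
have := (E true, E false); rewrite /nx /pv => -[[-> ->] [-> ->]].
by case: d d1 d2 {H E} => -[] [] /=; rewrite /dsign; lra.
Qed.

Lemma gv_off v : v \notin p -> gv v = 0.
Proof.
move=> vp; have H w : infix [:: w; v] p = false.
  by apply/negP => /infixP[x [y E]]; rewrite E !mem_cat !inE eqxx !orbT in vp.
by rewrite /gv /enters_north /enters_west /= !H.
Qed.

Lemma infix_mem t v : infix t p -> v \in t -> v \in p.
Proof. by move=> /infixP[x [y ->]] vt; rewrite !mem_cat vt orbT. Qed.

Lemma turns_turnE d1 d2 v : infix [:: pv d1 v; v; nx d2 v] p -> turns p v = (d1 != d2).
Proof.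
move=> H; rewrite /turns /enters_north /enters_west /leaves_east /leaves_south /=.
have E d' := infix_turnE d' H.
have := (E true, E false); rewrite /nx /pv => -[[-> ->] [-> ->]].
by case: d1 d2 {H E} => -[].
Qed.

(** The sum telescopes by [gv_turnE], and every turn flips the direction, which gives the parity. *)
Lemma infix_telescope d1 c u d2 d :
  infix (pv d1 c :: (c :: u) ++ [:: nx d2 (last c u)]) p ->
  (dsign d * sm gv (c :: u) = (d == d2)%:R - (d == d1)%:R) *
  (odd (count (turns p) (c :: u)) = (d1 != d2)).
Proof.
elim: u c d1 => [|w u IH] c d1 H.
  have H' : infix [:: pv d1 c; c; nx d2 c] p by [].
  rewrite sm_cons sm_nil addr0 (gv_turnE d H'); split=> //=.
  by rewrite (turns_turnE H') addn0; case: (_ != _).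
have /stepP[d3 Ew] : step c w.
  have := sorted_infix (is_path_sorted Pp) H; by rewrite /= => /and3P[].
have H1 : infix [:: pv d1 c; c; nx d3 c] p.
  by rewrite -Ew; exact: (@catr_infix _ (u ++ [:: nx d2 (last c (w :: u))]) [:: pv d1 c; c; w] _ H).
have /IH[E1 E2] : infix (pv d3 w :: (w :: u) ++ [:: nx d2 (last w u)]) p.
  by rewrite {1}Ew pv_nx; exact: (@catl_infix _ [:: pv d1 c] _ _ H).
rewrite sm_cons mulrDr E1 (gv_turnE d H1) /= oddD (turns_turnE H1).
split; first by lra.
by rewrite [in LHS]/= in E2 *; rewrite E2; case: (d1); case: (d2); case: (d3).
Qed.

Definition at_left d (a : seq vertex) c := a = [::] \/ exists a', a = rcons a' (pv d c).
Definition at_right d v (b : seq vertex) := b = [::] \/ exists b', b = nx d v :: b'.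

(** The common run open at the end of [t]: [p] enters [c] in direction [d] and then follows [t],
    whereas [t] starts at [c] or reaches it in the other direction. *)
Definition run d t := exists a c u,
  [/\ t = a ++ c :: u, infix (pv d c :: c :: u) p & at_left (~~ d) a c].

Lemma run_new d t v : infix [:: pv d v; v] p -> run d (rcons (rcons t (pv (~~ d) v)) v).
Proof.
move=> H; exists (rcons t (pv (~~ d) v)), v, [::]; split=> //; first by rewrite cats1.
by right; exists t.
Qed.

Lemma run_last d t v : run d (rcons t v) -> exists a c u,
  [/\ rcons t v = a ++ c :: u, infix (pv d c :: c :: u) p, at_left (~~ d) a c
    & v = last c u].
Proof.
move=> [a [c [u [E H L]]]]; exists a, c, u; split=> //.
by rewrite -[LHS](last_rcons v t v) E last_cat.
Qed.

Lemma run_mem d t v : run d (rcons t v) -> v \in p.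
Proof.
move=> /run_last[a [c [u [_ H _ ->]]]]; apply: (infix_mem H).
by rewrite inE mem_last orbT.
Qed.

Lemma run_extend d t v w : run d (rcons t v) -> infix [:: v; w] p ->
  run d (rcons (rcons t v) w).
Proof.
move=> /run_last[a [c [u [E H L Ev]]]] vw; exists a, c, (rcons u w); split=> //.
  by rewrite E -!cats1 -!catA.
case/lastP: u H Ev {E} => [|u x] H; rewrite ?last_rcons /= => Ev; subst.
  exact: (@infix_glue _ _ c [:: pv d c] [:: w]).
have := @infix_glue _ p x (pv d c :: c :: u) [:: w] U.
by rewrite -!cats1 -!catA /=; apply=> //; rewrite !cats1.
Qed.

(* Scan [t] from left to right.  If the conclusion fails, every maximal common
   run of [p] and [t] already left behind contributes nonnegatively, so each
   prefix sum is at least the contribution of the current run. *)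
Lemma neg_common_segment d t : t != [::] -> sorted step t ->
  all (interior_vertex lam) t -> dsign d * sm gv t < 0 ->
  exists a c u b, [/\ t = a ++ (c :: u) ++ b,
    infix (pv d c :: (c :: u) ++ [:: nx (~~ d) (last c u)]) p,
    at_left (~~ d) a c & at_right d (last c u) b].
Proof.
pose bad t b := exists a c u, [/\ t = a ++ (c :: u) ++ b,
    infix (pv d c :: (c :: u) ++ [:: nx (~~ d) (last c u)]) p,
    at_left (~~ d) a c & at_right d (last c u) b].
have run_bad t' v b : run d (rcons t' v) -> infix [:: v; nx (~~ d) v] p ->
    at_right d v b -> bad (rcons t' v ++ b) b.
  move=> /run_last[a [c [u [E H L Ev]]]] vw Rb; exists a, c, u.
  rewrite -Ev; split=> //; first by rewrite E -catA.
  move: vw; rewrite Ev; case/lastP: u {Ev E} H => [|u x] H; rewrite ?last_rcons /= => vw.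
    exact: (@infix_glue _ _ c [:: pv d c] [:: nx (~~ d) c]).
  have := @infix_glue _ p x (pv d c :: c :: u) [:: nx (~~ d) x] U.
  by rewrite -!cats1 -!catA /=; apply=> //; rewrite !cats1.
case/lastP: t => // t v _ S I neg.
(* Invariant of the scan at the last vertex [v]: the segment is found, or [p] misses [v], or a run
   entered in direction [~~ d] or [d] is open; the lower bound is then the telescoped contribution
   of that run. The condition [b != [::]] is there because a segment ending at [v] may fail
   [at_right] once the list grows. *)
suff: (exists2 b, b != [::] & bad (rcons t v) b) \/
  [\/ v \notin p /\ 0 <= dsign d * sm gv (rcons t v),
      run (~~ d) (rcons t v) /\ (infix [:: v; nx d v] p)%:R <= dsign d * sm gv (rcons t v)
    | run d (rcons t v) /\ - (infix [:: v; nx (~~ d) v] p)%:R <= dsign d * sm gv (rcons t v)].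
  case=> [[b _ [a [c [u H]]]]|[[_ h]|[_ h]|[r h]]]; first by exists a, c, u, b.
  - lra.
  - by have := ler0n R (infix [:: v; nx d v] p); lra.
  have vw : infix [:: v; nx (~~ d) v] p by case: infix h => //= h; lra.
  have := run_bad t v [::] r vw; rewrite cats0 => -[|a [c [u H]]]; first by left.
  by exists a, c, u, [::].
elim/last_ind: t v S I {neg} => [|t v IH] w S I.
  have iw : interior_vertex lam w by move: I => /= /andP[].
  rewrite /= sm_cons sm_nil addr0; right.
  have [wp|wp] := boolP (w \in p); last by constructor 1; rewrite gv_off// mulr0.
  have [d1 [d2 H]] := path_interior_mem Pp iw wp.
  rewrite (gv_turnE d H) !(infix_turnE _ H).
  have r : run d1 [:: w].
    exists [::], w, [::]; split=> //; last by left.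
    exact: infix3l H.
  have [Ed|Ed] : d1 = d \/ d1 = ~~ d by case: (d1); case: (d); auto.
    constructor 3; split; first by rewrite -Ed.
    by rewrite Ed; case: (d); case: (d2) => /=; lra.
  constructor 2; split; first by rewrite -Ed.
  by rewrite Ed; case: (d); case: (d2) => /=; lra.
have iw : interior_vertex lam w by move: I; rewrite all_rcons => /andP[].
have I' : all (interior_vertex lam) (rcons t v) by move: I; rewrite all_rcons => /andP[].
have iv : interior_vertex lam v by move: I'; rewrite all_rcons => /andP[].
have /stepP[d3 Ew] : step v w.
  by move: S; rewrite -!cats1 -catA => /cat_sorted2[_] /= /andP[].
have S' : sorted step (rcons t v) by move: S; rewrite -[rcons (rcons _ _) _]cats1 => /cat_sorted2[].
have Ev : v = pv d3 w by rewrite Ew pv_nx.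
rewrite sm_rcons mulrDr; case: (IH v S' I') => [[b b0 [a [c [u [E H L Rb]]]]]|].
  left; exists (rcons b w); first by case: (b).
  exists a, c, u; split=> //; first by rewrite E -!cats1 -!catA.
  by case: Rb b0 => [->//|[b' ->] _]; right; exists (rcons b' w).
set h := dsign d * _ => hyp.
have gw0 : w \notin p -> gv w = 0 by exact: gv_off.
have wp : infix [:: v; w] p -> w \in p by move/infix_mem; apply; rewrite !inE eqxx orbT.
have [vp|vp] := boolP (v \in p); last first.
  right; have h0 : 0 <= h.
    by case: hyp => -[] // /run_mem; rewrite (negbTE vp).
  have [wp'|wp'] := boolP (w \in p); last by constructor 1; rewrite gw0// mulr0 addr0.
  have [d1 [d2 H]] := path_interior_mem Pp iw wp'.
  have I1 : infix [:: pv d1 w; w] p by exact: infix3l H.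
  have Ed : d3 = ~~ d1.
    apply/eqP; rewrite -[d3 == _]negbK; apply/negP => Hd.
    have E31 : d3 = d1 by move: Hd; case: (d3); case: (d1).
    by move/negP: vp; apply; rewrite Ev E31; apply: (infix_mem I1); rewrite inE eqxx.
  have r : run d1 (rcons (rcons t v) w) by rewrite Ev Ed; exact: run_new.
  rewrite (gv_turnE d H) !(infix_turnE _ H).
  have [Ed1|Ed1] : d1 = d \/ d1 = ~~ d by case: (d1); case: (d); auto.
    constructor 3; split; first by rewrite -Ed1.
    by rewrite Ed1; case: (d); case: (d2) => /=; lra.
  constructor 2; split; first by rewrite -Ed1.
  by rewrite Ed1; case: (d); case: (d2) => /=; lra.
have [dv1 [dv2 Hv]] := path_interior_mem Pp iv vp.
move: hyp; rewrite !(infix_turnE _ Hv) => hyp.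
have I2 : infix [:: v; nx dv2 v] p by exact: infix3r Hv.
(* Either [p] follows [t] to [w] and the run goes on, or they part at [v]. *)
have [E32|E32] : dv2 = d3 \/ dv2 = ~~ d3 by case: (dv2); case: (d3); auto.
  have vw : infix [:: v; w] p by rewrite Ew -E32.
  have [d1 [d2 H]] := path_interior_mem Pp iw (wp vw).
  have E13 : d1 = d3.
    apply/eqP; have := (infix_turnE d3 H).2; rewrite -Ev vw => /esym/eqP->//.
  right; rewrite (gv_turnE d H) !(infix_turnE _ H).
  case: hyp => [[nv _]|[r hr]|[r hr]]; first by rewrite vp in nv.
    constructor 2; split; first exact: run_extend.
    by move: hr; rewrite E13 E32; case: (d); case: (d2); case: (d3) => /=; lra.
  constructor 3; split; first exact: run_extend.
  by move: hr; rewrite E13 E32; case: (d); case: (d2); case: (d3) => /=; lra.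
have {}hyp : (run (~~ d) (rcons t v) /\ (d == dv2)%:R <= h) \/
    (run d (rcons t v) /\ - (~~ d == dv2)%:R <= h).
  by case: hyp => [[]|H|H]; [rewrite vp|left|right].
have [bd|nbd] := EM ((exists2 b, b != [::] & bad (rcons (rcons t v) w) b)); first by left.
(* When a run closes without yielding the segment, the prefix sum is nonnegative. *)
right; have h0 : 0 <= h.
  case: hyp => -[r]; rewrite E32; first by apply: le_trans; exact: ler0n.
  have [Edd|Edd] : d = d3 \/ d = ~~ d3 by case: (d); case: (d3); auto.
    case: nbd; exists [:: w] => //; rewrite -cats1; apply: run_bad => //.
      by rewrite Edd -E32; exact: I2.
    by right; exists [::]; rewrite Ew Edd.
  by rewrite Edd; case: (d3) => /=; lra.
have [wp'|wp'] := boolP (w \in p); last by constructor 1; rewrite gw0// mulr0 addr0.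
have [d1 [d2 H]] := path_interior_mem Pp iw wp'.
have I1 : infix [:: pv d1 w; w] p by exact: infix3l H.
have Ed : d3 = ~~ d1.
  apply/eqP; rewrite -[d3 == _]negbK; apply/negP => Hd.
  have E31 : d3 = d1 by move: Hd; case: (d3); case: (d1).
  have vw : infix [:: v; nx d3 v] p by rewrite -Ew {1}Ev E31.
  by move: vw; rewrite (infix_turnE _ Hv) E32; case: (d3).
have r : run d1 (rcons (rcons t v) w) by rewrite Ev Ed; exact: run_new.
rewrite (gv_turnE d H) !(infix_turnE _ H).
have [Ed1|Ed1] : d1 = d \/ d1 = ~~ d by case: (d1); case: (d); auto.
  constructor 3; split; first by rewrite -Ed1.
  by move: h0; rewrite Ed1; case: (d); case: (d2) => /=; lra.
constructor 2; split; first by rewrite -Ed1.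
by move: h0; rewrite Ed1; case: (d); case: (d2) => /=; lra.
Qed.

End GVector.

(** * Decomposition into compatible paths *)

Section BoundedSeqs.
Context {T : eqType}.
Implicit Types l s : seq T.

Fixpoint bounded_seqs l n : seq (seq T) :=
  if n is n'.+1 then [::] :: [seq v :: s | v <- l, s <- bounded_seqs l n']
  else [:: [::]].

Lemma mem_bounded_seqs l n s : all (mem l) s -> (size s <= n)%N -> s \in bounded_seqs l n.
Proof.
elim: n s => [|n IH] [|v s] //= /andP[vl sl] sn; rewrite inE; apply/orP; right.
by apply/allpairsP; exists (v, s); split=> //; exact: IH.
Qed.

Lemma uniq_bounded_seqs l s : uniq s -> all (mem l) s -> s \in bounded_seqs l (size l).
Proof.
by move=> us /[dup] sl /allP sl'; apply: mem_bounded_seqs => //; apply: uniq_leq_size.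
Qed.

End BoundedSeqs.

Section Decomposition.
Variables (R : realType) (lam : {fset vertex}).
Implicit Types (f x y : vertex -> R) (p q s t u : seq vertex) (c v w : vertex) (d : bool).

Definition compatible f p : Prop :=
  [/\ is_path lam p, ~~ horizontal p, ~~ vertical p &
    forall d c u, infix (pv (~~ d) c :: (c :: u) ++ [:: nx d (last c u)]) p ->
      0 < dsign d * sm f (c :: u)].

(** A finite stock of lists containing all paths and segments, from which finite sets are cut out by
    arbitrary properties. *)
Definition all_seqs : seq (seq vertex) :=
  bounded_seqs (enum_fset lam) (size (enum_fset lam)).

Lemma is_path_lam p : is_path lam p -> all (mem (enum_fset lam)) p.
Proof.
case: p => // v t P; apply/allP => u ut.
have bd w : boundary_vertex lam w -> w \in enum_fset lam by move=> /andP[].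
case/path.splitPr E : _ / ut => [a b].
case: a E => [|a0 a] E; first by case/and5P: P => _ _ /bd; case: E => ->.
case: b E => [|b0 b] E.
  case: E P => _ -> /and5P[_ _ _]; rewrite last_cat /= => /bd//.
by have /andP[] := is_path_inner1 P E isT isT.
Qed.

Lemma is_path_all_seqs p : is_path lam p -> p \in all_seqs.
Proof.
by move=> P; apply: uniq_bounded_seqs; [exact: is_path_uniq P|exact: is_path_lam].
Qed.

Definition compatible_set f : {fset seq vertex} :=
  [fset p | p in all_seqs & `[< compatible f p >]]%fset.

Lemma in_compatible_set f p : p \in compatible_set f <-> compatible f p.
Proof.
rewrite !inE; split=> [/andP[_ /asboolP]//|H]; apply/andP; split; last exact/asboolP.
by case: H => /is_path_all_seqs.
Qed.

Lemma compatible_turn p : is_path lam p -> ~~ horizontal p -> ~~ vertical p ->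
  exists d c, infix [:: pv (~~ d) c; c; nx d c] p.
Proof.
move=> P nh nv; have := is_path_sorted P.
suff : [\/ horizontal p, vertical p | sorted step p -> exists d c, infix [:: pv (~~ d) c; c; nx d c] p].
  by case=> [H|H|//]; [rewrite H in nh|rewrite H in nv].
elim: p {P nh nv} => [|v p IH]; first by constructor 1.
case: p IH => [|w [|z p]] IH; first by constructor 1.
  have [/stepP[[] ->]|st] := boolP (step v w).
  - by constructor 1; rewrite /horizontal /= /nx eqxx.
  - by constructor 2; rewrite /vertical /= /nx eqxx.
  - by constructor 3 => /=; rewrite (negbTE st).
have [/and3P[/stepP[d1 E1] /stepP[d2 E2] st]|st] := boolP (path step v [:: w, z & p]); last first.
  by constructor 3 => S; rewrite /= in st S; rewrite S in st.
case: IH => H.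
- have E2' : z = nx true w by case/andP: H => /eqP.
  case: d1 E1 => E1; first by constructor 1; move: H; rewrite /horizontal /= E1 /nx eqxx.
  constructor 3 => _; exists true, w; rewrite E1 pv_nx -E1 -E2'.
  by rewrite infix_consl /= !eqxx prefix0s.
- have E2' : z = nx false w by case/andP: H => /eqP.
  case: d1 E1 => E1; last by constructor 2; move: H; rewrite /vertical /= E1 /nx eqxx.
  constructor 3 => _; exists false, w; rewrite E1 pv_nx -E1 -E2'.
  by rewrite infix_consl /= !eqxx prefix0s.
constructor 3 => /= /andP[_ /H[d [c I]]]; exists d, c.
exact: infix_trans I (infix_cons _ _).
Qed.

Lemma turn_not_straight p d c : infix [:: pv (~~ d) c; c; nx d c] p ->
  ~~ horizontal p /\ ~~ vertical p.
Proof.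
move=> /infixP[a [b ->]]; split; apply/negP => /cat_sorted2[_] /cat_sorted2[] /= /and3P[/eqP E1 /eqP E2 _] _.
  have /nx_inj : nx true (pv (~~ d) c) = nx (~~ d) (pv (~~ d) c) by rewrite nx_pv [RHS]E1.
  by have /nx_inj -> : nx d c = nx true c := E2.
have /nx_inj : nx false (pv (~~ d) c) = nx (~~ d) (pv (~~ d) c) by rewrite nx_pv [RHS]E1.
by have /nx_inj -> : nx d c = nx false c := E2.
Qed.

(* Subtracting from [f] as much of [gv p] as possible: a turning segment [t] of a
   path compatible with the difference cannot have negative [gv p]-sum, since by
   [neg_common_segment] it would contain a segment on which [f] is too small. *)
Lemma compatible_shrink f p : compatible f p -> exists2 r : R, 0 <= r &
  ~ compatible (fun v => f v + (- r) * gv R p v) p /\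
  forall q, compatible (fun v => f v + (- r) * gv R p v) q -> compatible f q.
Proof.
move=> /[dup] Cp [Pp nh nv Hp].
pose Q t := `[< exists d c u, t = c :: u /\ infix (pv (~~ d) c :: (c :: u) ++ [:: nx d (last c u)]) p >].
pose L := [seq t <- all_seqs | Q t].
have inL d c u : infix (pv (~~ d) c :: (c :: u) ++ [:: nx d (last c u)]) p -> c :: u \in L.
  move=> I; rewrite mem_filter; apply/andP; split; first by apply/asboolP; exists d, c, u.
  have I' : infix (c :: u) p by apply: infix_trans I; exact: (@infix_infix _ [:: _] (c :: u) [:: _]).
  apply: uniq_bounded_seqs.
    by have := is_path_uniq Pp; case/infixP: I' => [a [b ->]]; rewrite !cat_uniq => /and5P[_ _ /andP[]//].
  by have := is_path_lam Pp; case/infixP: I' => [a [b ->]]; rewrite !all_cat => /and3P[].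
have [d0 [c0 I0]] := compatible_turn Pp nh nv.
have L0 : L != [::] by apply/eqP => L0; have := inL d0 c0 [::] I0; rewrite L0.
(* The least absolute [f]-sum over the turning segments of [p] serves as [r]: it brings the
   minimising segment to sum zero. *)
have [t tL min] := seq_argmin (fun t => `|sm f t|) L0.
set r := `|sm f t| in min.
have rle d c u : infix (pv (~~ d) c :: (c :: u) ++ [:: nx d (last c u)]) p ->
    r <= dsign d * sm f (c :: u).
  move=> I; apply: le_trans (min _ (inL _ _ _ I)) _; have := Hp _ _ _ I.
  rewrite /dsign; case: (d); rewrite ?mul1r ?mulN1r => H; first by rewrite gtr0_norm.
  by rewrite ltr0_norm //; lra.
exists r; first exact: normr_ge0.
split=> [[_ _ _ H]|q [Pq nhq nvq Hq]].
  move: tL; rewrite mem_filter => /andP[/asboolP[d [c [u [Et I]]]] _].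
  have := H _ _ _ I; rewrite smD mulrDr mulrCA (infix_telescope R Pp d I).1 eqxx.
  have := Hp _ _ _ I; rewrite -Et /r /dsign; case: (d) => /=; rewrite ?mul1r ?mulN1r => H1.
    by rewrite gtr0_norm //; lra.
  by rewrite ltr0_norm //; lra.
split=> // d c u I; rewrite ltNge; apply/negP => le0.
have inner := is_path_inner Pq I.
have srt : sorted step (c :: u).
  have /path_sorted : path step (pv (~~ d) c) ((c :: u) ++ [:: nx d (last c u)]).
    exact: (sorted_infix (is_path_sorted Pq) I).
  by case/cat_sorted2.
have r0 : 0 <= r := normr_ge0 _.
have := Hq _ _ _ I; rewrite smD mulrDr mulrCA => pos.
have neg : dsign d * sm (gv R p) (c :: u) < 0.
  rewrite ltNge; apply/negP => ge0; have := mulr_ge0 r0 ge0; lra.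
have [//|a [c' [u' [b [E I' La Rb]]]]] := neg_common_segment Pp _ srt inner neg.
(* [p] enters this part in direction [d] and leaves it in direction [~~ d]; for [q] the directions
   are exchanged, by the course of [c :: u] or by the entering and leaving steps of [q] itself. *)
have I2 : infix (pv (~~ d) c' :: (c' :: u') ++ [:: nx d (last c' u')]) q.
  apply: infix_trans I; rewrite E.
  have Ea : exists a', pv (~~ d) c :: a = rcons a' (pv (~~ d) c').
    case: La => [a0|[a' ->]]; last by exists (pv (~~ d) c :: a').
    by exists [::]; move: E; rewrite a0 => -[-> _].
  have Eb : exists b', b ++ [:: nx d (last c u)] = nx d (last c' u') :: b'.
    case: Rb => [b0|[b' ->]]; last by exists (b' ++ [:: nx d (last c u)]).
    exists [::]; have := congr1 (last c) E; rewrite b0 cats0 last_cat /= => ->//.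
  have [a' Ea'] := Ea; have [b' Eb'] := Eb.
  rewrite -!catA Eb' -[pv (~~ d) c :: _]/((pv (~~ d) c :: a) ++ _) Ea' cat_rcons.
  by apply/infixP; exists a', b'; rewrite /= -!catA.
have I1 : infix (pv (~~ ~~ d) c' :: (c' :: u') ++ [:: nx (~~ d) (last c' u')]) p by rewrite negbK.
(* On the common part the signed [f]-sum is at most [- r] and that of [gv R p] is -1, so their
   combination cannot be positive. *)
have := rle _ _ _ I1; have := Hq _ _ _ I2; rewrite smD mulrDr mulrCA dsignN mulNr.
have := (infix_telescope R Pp d I1).1; rewrite negbK eqxx => ->.
by case: (d) => /=; lra.
Qed.

(* [lab f r v l]: the strand at position [r] leaves [v] along [l]; its position
   is shifted by [f w] at each vertex [w], and it goes East iff it is positive. *)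
Fixpoint lab f (r : R) v l : bool :=
  if l is w :: l' then (w == nx (0 < r) v) && lab f (r + f w) w l' else true.

Lemma lab_catr f r v l1 w l2 : lab f r v (l1 ++ w :: l2) ->
  exists r', lab f r' (last v l1) (w :: l2).
Proof.
by elim: l1 r v => [|z l1 IH] r v; [exists r|move=> /andP[_ /IH]].
Qed.

Lemma lab_step f r v l : lab f r v l -> path step v l.
Proof.
elim: l r v => //= w l IH r v /andP[/eqP-> /IH->]; by rewrite step_nx.
Qed.

Lemma lab_end f r v l z b : lab f r v (l ++ z :: b) ->
  z = nx (0 < r + sm f l) (last v l).
Proof.
elim: l r v => [|w l IH] r v /= /andP[/eqP E H]; first by rewrite sm_nil addr0.
by rewrite sm_cons addrA; exact: IH.
Qed.

(** The position is positive exactly before East steps, so between steps of different directions it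
    changes sign in the sense required. *)
Lemma lab_compatible f r v l d c u : lab f r v l ->
  infix (pv (~~ d) c :: (c :: u) ++ [:: nx d (last c u)]) (v :: l) ->
  0 < dsign d * sm f (c :: u).
Proof.
move=> H /infixP[a [b E]].
have [r' H'] : exists r', lab f r' (pv (~~ d) c) ((c :: u) ++ nx d (last c u) :: b).
  case: a E => [|a0 a] /= [Ev E].
    by exists r; rewrite -Ev; move: H; rewrite E -catA.
  have := H; rewrite E [a ++ _ :: _](_ : _ = (rcons a (pv (~~ d) c)) ++
      c :: (u ++ [:: nx d (last c u)]) ++ b); last by rewrite cat_rcons.
  by move/lab_catr => [r']; rewrite last_rcons -catA => ?; exists r'.
have Ec : (0 < r') = ~~ d.
  by case/andP: (H') => /eqP; rewrite -{1}(nx_pv (~~ d) c) => /nx_inj.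
have /nx_inj Ed := lab_end H'.
move: Ec Ed; rewrite /dsign; case: (d) => /= /esym; case: ltrP => // h1 _ /esym; case: ltrP => // h2 _; lra.
Qed.

Lemma interior_pv v d : interior_vertex lam v -> pv d v \in lam.
Proof. by case/and5P; case: d. Qed.

Lemma interior_nx v d : interior_vertex lam v -> nx d v \in lam.
Proof. by case/and5P; case: d. Qed.

Lemma not_boundary v : v \in lam -> ~~ boundary_vertex lam v -> interior_vertex lam v.
Proof. by rewrite /boundary_vertex => -> /negPn. Qed.

(** Follow the strand until it meets the boundary; each step leaves fewer vertices of [lam] at the
    current level or above. *)
Lemma lab_forward f v r : v \in lam -> exists l, [/\ lab f r v l,
  boundary_vertex lam (last v l), all (interior_vertex lam) (belast v l) &
  interior_vertex lam v -> exists l', l = nx (0 < r) v :: l'].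
Proof.
have [n] := ubnP #|` [fset w in lam | lev v <= lev w]|%fset.
elim: n v r => // n IH v r le vl.
have [bv|/(not_boundary vl) iv] := boolP (boundary_vertex lam v).
  by exists [::]; split=> // iv; rewrite /boundary_vertex iv andbF in bv.
set w := nx (0 < r) v; have wl : w \in lam by exact: interior_nx.
have lw : lev w = lev v + 1 by apply/lev_step/step_nx.
have [|l [H1 H2 H3 _]] := IH w (r + f w) _ wl; last first.
  exists (w :: l); split=> //=; rewrite ?eqxx ?iv//.
  by exists l.
rewrite ltnS in le; apply: leq_trans le; apply: fproper_ltn_card; rewrite fproperE; apply/andP; split.
  by apply/fsubsetP => z; rewrite !inE => /andP[-> /=]; lia.
by apply/fsubsetPn; exists v; rewrite !inE vl //= ?lexx//; lia.
Qed.

(** A strand leaving [v] at position [r] arrived at position [r - f v], which determines the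
    preceding vertex. *)
Lemma lab_backward f v r l : v \in lam -> lab f r v l -> exists v0 l0 r0,
  [/\ lab f r0 v0 (l0 ++ l), boundary_vertex lam v0, last v0 l0 = v,
   all (interior_vertex lam) l0 &
   interior_vertex lam v -> exists l', v0 :: l0 = l' ++ [:: pv (0 < r - f v) v; v]].
Proof.
have [n] := ubnP #|` [fset w in lam | lev w <= lev v]|%fset.
elim: n v r l => // n IH v r l le vl Hl.
have [bv|/(not_boundary vl) iv] := boolP (boundary_vertex lam v).
  by exists v, [::], r; split=> // iv; rewrite /boundary_vertex iv andbF in bv.
set w := pv (0 < r - f v) v; have wl : w \in lam by exact: interior_pv.
have lw : lev v = lev w + 1 by apply/lev_step/step_pv.
have [||v0 [l0 [r0 [H1 H2 H3 H4 _]]]] := IH w (r - f v) (v :: l) _ wl; last first.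
- exists v0, (rcons l0 v), r0; rewrite cat_rcons last_rcons all_rcons iv; split=> //.
  move=> _; case/lastP: l0 H3 {H1 H4} => [|l0 z]; rewrite ?last_rcons /= => ->; first by exists [::].
  by exists (v0 :: l0); rewrite -!cats1 -catA.
- by rewrite /= nx_pv eqxx subrK.
rewrite ltnS in le; apply: leq_trans le; apply: fproper_ltn_card; rewrite fproperE; apply/andP; split.
  by apply/fsubsetP => z; rewrite !inE => /andP[-> /=]; lia.
by apply/fsubsetPn; exists v; rewrite !inE vl //= ?lexx//; lia.
Qed.

Lemma lab_is_path f v0 l0 r0 v l : lab f r0 v0 (l0 ++ v :: l) ->
  boundary_vertex lam v0 -> boundary_vertex lam (last v l) ->
  all (interior_vertex lam) l0 -> all (interior_vertex lam) (belast v l) ->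
  is_path lam (v0 :: l0 ++ v :: l).
Proof.
move=> H b0 bl a0 al; apply/and5P; split=> //.
- by case: (l0).
- exact: lab_step H.
- by rewrite last_cat.
- rewrite belast_cat; case/lastP: l0 a0 {H} => [|l0 z] //=.
  by rewrite belast_rcons last_rcons /= all_cat all_rcons /= al => /andP[-> ->].
Qed.

(** Trace a strand both ways so that it turns at [c]: it is compatible by [lab_compatible], and not
    straight. *)
Lemma exists_compatible f c : interior_vertex lam c -> f c != 0 ->
  exists p, compatible f p.
Proof.
move=> ic fc.
suff [p [d [Pp I H]]] : exists p d, [/\ is_path lam p, infix [:: pv (~~ d) c; c; nx d c] p &
    forall d c u, infix (pv (~~ d) c :: (c :: u) ++ [:: nx d (last c u)]) p -> 0 < dsign d * sm f (c :: u)].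
  by have [? ?] := turn_not_straight I; exists p.
have cl : c \in lam by case/and5P: ic.
have [lt|gt|/eqP] := ltrgtP (f c) 0; last by rewrite (negbTE fc).
  (* For [f c < 0], leave [c] at position 0, hence to the South; the earlier position [- f c] is
     positive, so [c] is entered from the West. *)
  have [l [L1 L2 L3 _]] := lab_forward f (0 + f (south c)) (interior_nx false ic).
  have [|v0 [l0 [r0 [B1 B2 B3 B4 B5]]]] := @lab_backward f c 0 (south c :: l) cl.
    by rewrite /= ltxx eqxx; exact: L1.
  exists (v0 :: l0 ++ south c :: l), false; split; last by move=> d c' u; exact: (lab_compatible B1).
    exact: (lab_is_path B1).
  have [l' E] := B5 ic; rewrite -cat_cons E; apply/infixP; exists l', l.
  by rewrite -!catA /= sub0r oppr_gt0 lt.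
(* For [0 < f c], arrive from the North at position 0 and leave at position [f c], hence to the
   East. *)
have [l [L1 L2 L3 L4]] := lab_forward f (0 + f c) cl.
have [|v0 [l0 [r0 [B1 B2 B3 B4 _]]]] := @lab_backward f (north c) 0 (c :: l) (interior_pv false ic).
  by rewrite /= ltxx (nx_pv false c : nx false (north c) = c) eqxx.
exists (v0 :: l0 ++ c :: l), true; split; last by move=> d c' u; exact: (lab_compatible B1).
  exact: (lab_is_path B1).
have [l' ->] := L4 ic; rewrite -cat_cons add0r gt.
have [k E] : exists k, v0 :: l0 = k ++ [:: north c].
  case/lastP: l0 B3 {B1 B4} => [|l0 z] /=; rewrite ?last_rcons => ->; first by exists [::].
  by exists (v0 :: l0); rewrite cats1.
by rewrite E; apply/infixP; exists k, l'; rewrite -catA.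
Qed.

(** Induction on the number of compatible paths: [compatible_shrink] removes one and adds none, and
    when none is left [f] vanishes on the interior by [exists_compatible]. *)
Lemma compatible_decomposition f : exists k : seq vertex -> R,
  (forall p, 0 <= k p) /\
  forall v, interior_vertex lam v -> f v = \sum_(p <- compatible_set f) k p * gv R p v.
Proof.
have [n] := ubnP #|` compatible_set f|; elim: n f => // n IH f le.
have [[p /[dup] Cp /in_compatible_set Cp']|none] := EM (exists p, compatible f p); last first.
  exists (fun=> 0); split=> // v iv; rewrite big1 => [|p _]; last by rewrite mul0r.
  by apply/eqP; apply/negPn/negP => /(exists_compatible iv).
have [r r0 [np sub]] := compatible_shrink Cp.
set f' := fun v => _ in np sub.
have subset : (compatible_set f' `<=` compatible_set f)%fset.
  by apply/fsubsetP => q /in_compatible_set/sub/in_compatible_set.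
have npf : p \notin compatible_set f' by apply/negP => /in_compatible_set.
have [|k [k0 Hk]] := IH f'.
  rewrite ltnS in le; apply: leq_trans le; apply: fproper_ltn_card; rewrite fproperE subset.
  by apply/fsubsetPn; exists p.
exists (fun q => (if q \in compatible_set f' then k q else 0) + (if q == p then r else 0)).
split=> [q|v iv]; first by apply: addr_ge0; case: ifP.
have := Hk v iv; rewrite /f' => /eqP; rewrite mulNr subr_eq => /eqP ->.
under [RHS]eq_bigr => q _ do rewrite mulrDl.
rewrite big_split /=; congr (_ + _).
  rewrite [RHS](big_fsetID _ (mem (compatible_set f'))) /= [X in _ = _ + X]big1_fset ?addr0; last first.
    by move=> q; rewrite !inE => /andP[_ /negbTE->] _; rewrite mul0r.
  rewrite (_ : [fset q | q in compatible_set f & q \in compatible_set f']%fset = compatible_set f').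
    by apply: eq_big_seq => q ->.
  apply/fsetP => q; rewrite [LHS]in_fset /=; apply/andP/idP => [[]//|H].
  by split=> //; exact: (fsubsetP subset).
rewrite (big_fsetD1 p) //= eqxx big1_fset ?addr0// => q; rewrite !inE => /andP[/negbTE-> _] _.
by rewrite mul0r.
Qed.

End Decomposition.

(** * Shards and semistability *)

Definition origin : vertex := (0, 0).

(* The direction of the step from the last vertex of [a] to the first vertex of
   [b]; meaningless if [a] or [b] is empty. *)
Definition heading (a b : seq vertex) : bool := head origin b == nx true (last origin a).

Section Semistable.
Variables (R : realType) (lam : {fset vertex}).
Implicit Types (f : vertex -> R) (p s t u a b : seq vertex) (c v : vertex) (d : bool).
Implicit Types (x : {ffun interior_set lam -> R}).

Definition semistable f s : Prop :=
  [/\ is_segment lam s, sm f s = 0 &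
    forall a b, s = a ++ b -> a != [::] -> b != [::] -> 0 <= dsign (heading a b) * sm f a].

Lemma heading_nx a v d b : heading (rcons a v) (nx d v :: b) = d.
Proof. by rewrite /heading last_rcons -[head _ _]/(nx d v) eq_nx eqb_id. Qed.

Lemma at_right_heading a b : sorted step (a ++ b) -> a != [::] -> b != [::] ->
  at_right (heading a b) (last origin a) b.
Proof.
case/lastP: a => // a v; case: b => // w b S _ _.
have /stepP[d ->] : step v w by move: S; rewrite cat_rcons => /cat_sorted2[_ /andP[]].
by right; exists b; rewrite heading_nx last_rcons.
Qed.

Lemma segment_cat a b : is_segment lam (a ++ b) ->
  (a != [::] -> is_segment lam a) /\ (b != [::] -> is_segment lam b).
Proof.
rewrite /is_segment all_cat => /and3P[_ /andP[ia ib] /cat_sorted2[sa sb]].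
by split=> ->; rewrite ?ia ?ib ?sa ?sb.
Qed.

Lemma segment_infix s t : is_segment lam s -> infix t s -> t != [::] -> is_segment lam t.
Proof.
move=> S /infixP[a [b E]] t0; move: S; rewrite E => /segment_cat[_ H].
have tb : t ++ b != [::] by case: (t) t0.
by have [H' _] := segment_cat (H tb); exact: H'.
Qed.

Lemma segment_step s v w : is_segment lam s -> infix [:: v; w] s -> step v w.
Proof. by case/and3P=> _ _ S /(sorted_infix S) /= /andP[]. Qed.

Lemma segment_uniq s : is_segment lam s -> uniq s.
Proof. by case/and3P=> _ _ /sorted_step_uniq. Qed.

(** Vertices repeat neither in [p] nor in [s], so a longer common part would contain a step into [c]
    or out of [last c u] shared by both, against the assumed divergence. *)
Lemma maximal_commonI s p a c u b d d' : is_path lam p -> is_segment lam s ->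
  s = a ++ (c :: u) ++ b ->
  infix (pv d c :: (c :: u) ++ [:: nx d' (last c u)]) p ->
  at_left (~~ d) a c -> at_right (~~ d') (last c u) b ->
  maximal_common_subsegment s p (c :: u).
Proof.
move=> Pp Ss E I La Rb; have Up := is_path_uniq Pp; have Us := segment_uniq Ss.
split=> //; first by rewrite E infix_infix.
  by apply: infix_trans I; exact: (@infix_infix _ [:: _] (c :: u) [:: _]).
move=> t ts tp /infixP[x [y Et]].
rewrite [LHS]Et; have -> : x = [::].
  case/lastP: x Et => // x w Et.
  have It : infix [:: w; c] t.
    by rewrite Et cat_rcons; apply/infixP; exists x, (u ++ y).
  have Ip : infix [:: pv d c; c] p.
    exact: (@catr_infix _ (u ++ [:: nx d' (last c u)]) [:: pv d c; c] _ I).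
  have Ew := infix_pred_inj Up (infix_trans It tp) Ip.
  have Is := infix_trans It ts.
  case: La => [a0|[a' Ea]].
    case/infixP: Is => x' [y' E'].
    have := uniq_cat_inj (v := c) (a := x' ++ [:: w]) (b := y') (a' := [::]) (b' := u ++ b).
    by rewrite -catA /= -E' => /(_ Us); rewrite E a0 => /(_ erefl)[]; case: (x').
  have : infix [:: pv (~~ d) c; c] s.
    by rewrite E Ea cat_rcons; apply/infixP; exists a', (u ++ b).
  by move=> /(infix_pred_inj Us Is); rewrite Ew => /pv_inj; case: (d).
have -> // : y = [::]; last by rewrite cats0.
case: y Et => // w y Et; set l := last c u in I Rb.
have Ecu : exists k, c :: u = rcons k l.
  by rewrite /l lastI; exists (belast c u).
have [k Ek] := Ecu.
have It : infix [:: l; w] t.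
  by rewrite Et Ek cat_rcons; apply/infixP; exists (x ++ k), y; rewrite -catA.
have Ip : infix [:: l; nx d' l] p.
  by apply: (@catl_infix _ (pv d c :: k)); rewrite /= -cat_rcons -Ek; exact: I.
have Ew := infix_succ_inj Up (infix_trans It tp) Ip.
have Is := infix_trans It ts.
case: Rb => [b0|[b' Eb]].
  case/infixP: Is => x' [y' E'].
  have := uniq_cat_inj (v := l) (a := x') (b := w :: y') (a' := a ++ k) (b' := [::]).
  by rewrite -[_ ++ l :: _]/(x' ++ [:: l; w] ++ y') -E' => /(_ Us); rewrite E b0 Ek cats0 -cats1 -catA => /(_ erefl)[].
have : infix [:: l; nx (~~ d') l] s.
  by rewrite E Eb Ek cat_rcons; apply/infixP; exists (a ++ k), b'; rewrite -catA.
by move=> /(infix_succ_inj Us Is); rewrite Ew => /nx_inj; case: (d').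
Qed.

(** The ends of [t] are interior, so [p] continues beyond both; where [s] continues too, maximality
    forces the other direction. *)
Lemma maximal_commonE s p t : is_path lam p -> is_segment lam s ->
  maximal_common_subsegment s p t -> exists a c u b d d',
  [/\ t = c :: u, s = a ++ (c :: u) ++ b,
    infix (pv d c :: (c :: u) ++ [:: nx d' (last c u)]) p,
    at_left (~~ d) a c & at_right (~~ d') (last c u) b].
Proof.
move=> Pp Ss [t0 ts tp max]; have Up := is_path_uniq Pp; have Us := segment_uniq Ss.
case: t t0 ts tp max => // c u _ /[dup] ts /infixP[a [b E]] tp max.
have int v : v \in c :: u -> exists d1 d2, infix [:: pv d1 v; v; nx d2 v] p.
  move=> vt; apply: (path_interior_mem Pp); last exact: infix_mem tp vt.
  by case/and3P: Ss => _ /allP/(_ v) + _; apply; rewrite E !mem_cat vt orbT.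
have [d [_ /infix3l Ic]] := int c (mem_head _ _).
have [_ [d' /infix3r Il]] := int _ (mem_last c u).
set l := last c u in Il.
have Ek : c :: u = rcons (belast c u) l by rewrite /l -lastI.
have IR : infix ((c :: u) ++ [:: nx d' l]) p.
  by rewrite Ek cat_rcons; apply: infix_glue => //; rewrite -Ek.
exists a, c, u, b, d, d'; split=> //.
- by have := @infix_glue _ p c [:: pv d c] (u ++ [:: nx d' l]) Up Ic IR.
- case/lastP: a E => [|a w] E; [by left|right].
  have Iwc : infix [:: w; c] s by rewrite E cat_rcons; apply/infixP; exists a, (u ++ b).
  have /step_pvP[d3 Ew] := segment_step Ss Iwc.
  suff -> : ~~ d = d3 by exists a; rewrite Ew.
  apply/eqP; rewrite eqb_negLR -[_ == _]negbK; apply/negP => H.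
  have Ed : d3 = d by move: H; case: (d3); case: (d).
  have := max (w :: c :: u); rewrite -Ed -Ew in Ic.
  have -> : infix (w :: c :: u) s by rewrite E cat_rcons; apply/infixP; exists a, b.
  have -> : infix (w :: c :: u) p.
    exact: (@infix_glue _ p c [:: w] u Up Ic tp).
  by move=> /(_ isT isT (infix_cons _ _)) /(congr1 size) /=; lia.
- case: b E => [|w b] E; [by left|right].
  have Ilw : infix [:: l; w] s by rewrite E Ek cat_rcons; apply/infixP; exists (a ++ belast c u), b; rewrite -catA.
  have /stepP[d3 Ew] := segment_step Ss Ilw.
  suff -> : ~~ d' = d3 by exists b; rewrite Ew.
  apply/eqP; rewrite eqb_negLR -[_ == _]negbK; apply/negP => H.
  have Ed : d3 = d' by move: H; case: (d3); case: (d').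
  have := max (rcons (c :: u) w); rewrite -Ed -Ew in IR.
  have -> : infix (rcons (c :: u) w) s by rewrite E -cat_rcons infix_infix.
  have -> : infix (rcons (c :: u) w) p by rewrite -cats1.
  by move=> /(_ isT isT (prefixW (prefix_rcons _ _))) /(congr1 size); rewrite size_rcons; lia.
Qed.

(** A prefix sum of the wrong sign would yield, by [neg_common_segment], a maximal common subsegment
    entered and left in different directions, hence with an odd number of turns. *)
Lemma semistable_gv p s : is_path lam p -> is_segment lam s ->
  (forall t, maximal_common_subsegment s p t -> ~~ odd (count (turns p) t)) ->
  semistable (gv R p) s.
Proof.
move=> Pp Ss even.
have pos d t r : s = t ++ r -> t != [::] -> at_right d (last origin t) r ->
    0 <= dsign d * sm (gv R p) t.
  move=> E t0 Rr; rewrite leNgt; apply/negP => neg.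
  have /and3P[_ it St] : is_segment lam t by apply: segment_infix Ss _ t0; rewrite E prefix_infix.
  have [a [c [u [b [Et I La Rb]]]]] := neg_common_segment Pp t0 St it neg.
  have Rbr : at_right (~~ ~~ d) (last c u) (b ++ r).
    rewrite negbK; case: Rb => [b0|[b' ->]]; last by right; exists (b' ++ r).
    by move: Rr; rewrite Et b0 cats0 last_cat.
  have Es : s = a ++ (c :: u) ++ (b ++ r) by rewrite E Et -!catA.
  have := even _ (maximal_commonI Pp Ss Es I La Rbr).
  by rewrite (infix_telescope R Pp d I).2; case: (d).
have s0 : s != [::] by case/and3P: Ss.
split=> // [|a b E a0 b0].
  (* With nothing to the right, both signs apply to the whole of [s]. *)
  have := pos true s [::]; have := pos false s [::]; rewrite cats0 /dsign => H1 H2.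
  by have := H1 erefl s0 (or_introl erefl); have := H2 erefl s0 (or_introl erefl); lra.
by apply: (pos _ _ _ E a0); apply: at_right_heading => //; rewrite -E; case/and3P: Ss.
Qed.

Definition ev x v : R := if insub v is Some w then x w else 0.

Lemma interior_setE v : (v \in interior_set lam) = interior_vertex lam v.
Proof.
rewrite !inE; apply/andP/idP => [[]//|iv]; split=> //=; by case/and5P: iv.
Qed.

Lemma ev_val x (w : interior_set lam) : ev x (val w) = x w.
Proof. by rewrite /ev valK. Qed.

Lemma semistable_eq f f' s : {in interior_vertex lam, f =1 f'} ->
  semistable f s -> semistable f' s.
Proof.
move=> E [Ss s0 H]; have Es a b : s = a ++ b -> sm f a = sm f' a.
  move=> Eab; apply: eq_sm => v va; apply: E; case/and3P: Ss => _ /allP/(_ v) + _.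
  by apply; rewrite Eab mem_cat va.
split=> //; first by rewrite -(Es s [::]) ?cats0.
by move=> a b Eab; rewrite -(Es _ _ Eab); exact: H.
Qed.

Lemma semistable_sum (F : seq (seq vertex)) (k : seq vertex -> R) (g : seq vertex -> vertex -> R) s :
  is_segment lam s -> (forall p, p \in F -> 0 <= k p) ->
  (forall p, p \in F -> semistable (g p) s) ->
  semistable (fun v => \sum_(p <- F) k p * g p v) s.
Proof.
move=> Ss k0 H.
have E t : sm (fun v => \sum_(p <- F) k p * g p v) t = \sum_(p <- F) k p * sm (g p) t.
  by rewrite /sm exchange_big /=; apply: eq_bigr => p _; rewrite mulr_sumr.
split=> // [|a b Eab a0 b0].
  by rewrite E big_seq big1 // => p /H[_ -> _]; rewrite mulr0.
rewrite E mulr_sumr big_seq; apply: sumr_ge0 => p pF.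
by rewrite mulrCA mulr_ge0 ?k0//; have [_ _] := H p pF; exact.
Qed.

(** Forward, nonnegative combinations preserve semistability. Backward, the paths compatible with
    [ev x] form the required face. *)
Lemma shardP s x : is_segment lam s -> shard R lam s x <-> semistable (ev x) s.
Proof.
move=> Ss; split=> [[F [[paths _] even] [k [k0 Ex]]]|].
  apply: (@semistable_eq (fun v => \sum_(p <- F) k p * gv R p v)).
    move=> v iv; have vI : v \in interior_set lam by rewrite interior_setE.
    rewrite -[v]/(val (Sub v vI : interior_set lam)) ev_val Ex.
    by apply: eq_bigr => p _; rewrite ffunE.
  apply: semistable_sum => // p pF; have [Pp _ _] := paths p pF.
  by apply: semistable_gv => // t; exact: even.
move=> [_ s0 H]; have [k [k0 Ek]] := compatible_decomposition lam (ev x).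
exists (compatible_set lam (ev x)); last first.
  exists k; split=> // v; rewrite -[LHS]ev_val Ek; last by rewrite -interior_setE; exact: valP.
  by apply: eq_bigr => p _; rewrite ffunE.
split; first split.
- by move=> p /in_compatible_set[].
(* Kissing would make the sum over the common segment both positive and negative. *)
- move=> p q /in_compatible_set Cp /in_compatible_set Cq t.
  case=> St K; case: t St K => // c u _.
  have glue q' d d' : is_path lam q' -> infix (pv d c :: c :: u) q' ->
      infix (rcons (c :: u) (nx d' (last c u))) q' ->
      infix (pv d c :: (c :: u) ++ [:: nx d' (last c u)]) q'.
    move=> /is_path_uniq Uq H1 H2; rewrite -cats1 in H2.
    have H1' : infix [:: pv d c; c] q' := @catr_infix _ u [:: pv d c; c] _ H1.
    exact: (@infix_glue _ q' c [:: pv d c] (u ++ [:: nx d' (last c u)]) Uq H1' H2).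
  have pos q' d : compatible lam (ev x) q' -> infix (pv (~~ d) c :: c :: u) q' ->
      infix (rcons (c :: u) (nx d (last c u))) q' -> 0 < dsign d * sm (ev x) (c :: u).
    by move=> [Pq _ _ Hq'] H1 H2; apply: Hq'; exact: glue.
  by case=> -[]; rewrite /enters_west /enters_north /leaves_south /leaves_east => H1 H2 H3 H4;
    [have := pos p false Cp H1 H2; have := pos q true Cq H3 H4
    |have := pos q false Cq H1 H2; have := pos p true Cp H3 H4]; rewrite /dsign; lra.
move=> p t /in_compatible_set[Pp _ _ Hp] /(maximal_commonE Pp Ss)[a [c [u [b [d [d' [-> E I La Rb]]]]]]].
rewrite (infix_telescope R Pp true I).2; apply/negP => dd'.
(* Semistability at the cuts before and after [c :: u] contradicts the sign that compatibility gives
   to its sum. *)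
have Ed : d = ~~ d' by move: dd'; case: (d); case: (d').
subst d; have := Hp _ _ _ I; rewrite negbK in La.
have : 0 <= dsign d' * sm (ev x) a.
  case: La => [->|[a' Ea]]; first by rewrite sm_nil mulr0.
  have Ea0 : a != [::] by rewrite Ea -cats1; case: (a').
  have := H a ((c :: u) ++ b) E Ea0 isT.
  have := heading_nx a' (pv d' c) d' (u ++ b); rewrite nx_pv => Hd.
  by rewrite {1}Ea [heading _ _]Hd.
have : 0 <= dsign (~~ d') * sm (ev x) (a ++ c :: u).
  case: Rb => [b0|[b' Eb]]; first by move: s0; rewrite E b0 cats0 => ->; rewrite mulr0.
  have E' : s = (a ++ c :: u) ++ b by rewrite E catA.
  have Hd := heading_nx (a ++ belast c u) (last c u) (~~ d') b'.
  have := H _ _ E'; rewrite Eb; rewrite rcons_cat -lastI in Hd; rewrite Hd; apply=> //.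
  by case: (a).
by rewrite dsignN sm_cat mulrDr mulNr; lra.
Qed.

End Semistable.

(** * Stable segments *)

Section StableSegments.
Variables (R : realType) (lam : {fset vertex}).
Implicit Types (f x y z : vertex -> R) (s t u r a b : seq vertex) (c v : vertex).

Notation semistable := (semistable lam).

Definition stable f s : Prop := semistable f s /\
  forall a b, s = a ++ b -> a != [::] -> b != [::] -> sm f a != 0.

Lemma segment_all_seqs s : is_segment lam s -> s \in all_seqs lam.
Proof.
move=> /[dup] /segment_uniq us /and3P[_ /allP i _]; apply: uniq_bounded_seqs => //.
by apply/allP => v /i /and5P[].
Qed.

Definition stables f : {fset seq vertex} :=
  [fset s | s in all_seqs lam & `[< stable f s >]]%fset.

Lemma in_stables f s : s \in stables f <-> stable f s.
Proof.
rewrite !inE; split=> [/andP[_ /asboolP]//|H]; apply/andP; split; last exact/asboolP.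
by case: H => -[/segment_all_seqs].
Qed.

Lemma semistable_neq0 f s : semistable f s -> s != [::].
Proof. by case=> /and3P[]. Qed.

Lemma semistable_sorted f s : semistable f s -> sorted step s.
Proof. by case=> /and3P[]. Qed.

Lemma heading_cat a b a' b' : a != [::] -> b != [::] ->
  heading (a' ++ a) (b ++ b') = heading a b.
Proof. by rewrite /heading; case: a => // v a; case: b => // w b _ _; rewrite last_cat. Qed.

Lemma semistable_slice f s a u b : semistable f s -> s = a ++ u ++ b -> u != [::] ->
  sm f a = 0 -> sm f u = 0 -> semistable f u.
Proof.
move=> [Ss s0 H] E u0 a0 u1; split=> // [|a' b' E' a'0 b'0].
  by apply: segment_infix Ss _ u0; rewrite E infix_infix.
have := H (a ++ a') (b' ++ b); rewrite E E' -!catA heading_cat// sm_cat a0 add0r.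
by apply=> //; [case: (a) (a') a'0 => [|? ?] [] | case: (b') b'0].
Qed.

Lemma semistable_cat f a b : is_segment lam (a ++ b) -> semistable f a ->
  semistable f b -> semistable f (a ++ b).
Proof.
move=> S [Sa a0 Ha] [Sb b0 Hb]; split=> // [|a' b' E a'0 b'0].
  by rewrite sm_cat a0 b0 addr0.
have [[m [Ea' Eb]]|[m [Ea Eb']]] := cat_eq_cat E.
  rewrite Ea' sm_cat a0 add0r; have [->|m0] := eqVneq m [::]; first by rewrite sm_nil mulr0.
  by rewrite -[b']cats0 heading_cat //; exact: Hb.
have [m0|m0] := eqVneq m [::].
  by move: Ea; rewrite m0 cats0 => <-; rewrite a0 mulr0.
by rewrite Eb' -[a']cat0s heading_cat // cat0s; exact: Ha.
Qed.

(** A segment that is not stable splits at a vanishing proper prefix sum into two shorter semistable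
    ones. *)
Lemma semistable_ind f (P : seq vertex -> Prop) :
  (forall u, stable f u -> P u) ->
  (forall a b, semistable f a -> semistable f b -> is_segment lam (a ++ b) ->
    P a -> P b -> P (a ++ b)) ->
  forall s, semistable f s -> P s.
Proof.
move=> Pst Pcat s; have [n] := ubnP (size s); elim: n s => // n IH s le H.
have [[a [b [E a0 b0 fa]]]|none] :=
  EM (exists a b, [/\ s = a ++ b, a != [::], b != [::] & sm f a = 0]); last first.
  apply: Pst; split=> // a b E a0 b0; apply/eqP => fa; apply: none; by exists a, b.
have fb : sm f b = 0 by have [_ + _] := H; rewrite E sm_cat fa add0r.
have Ha : semistable f a by apply: (semistable_slice (a := [::]) (b := b) H) => //; rewrite sm_nil.
have Hb : semistable f b by apply: (semistable_slice (a := a) (b := [::]) H) => //; rewrite cats0.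
move: le; rewrite E size_cat => le; apply: Pcat => //.
- by rewrite -E; case: H.
- by apply: IH => //; case: (b) b0 le => //= *; lia.
- by apply: IH => //; case: (a) a0 le => //= *; lia.
Qed.

Lemma first_stable f s : semistable f s -> exists u r,
  [/\ stable f u, s = u ++ r & r = [::] \/ semistable f r].
Proof.
elim/semistable_ind => [u Hu|a b Ha Hb Sab [u [r [Hu Ea Hr]]] _].
  by exists u, [::]; rewrite cats0; split=> //; left.
exists u, (r ++ b); rewrite Ea catA; split=> //; right.
case: Hr => [->//|Hr]; apply: semistable_cat => //.
apply: segment_infix Sab _ _; last by case: (r) (semistable_neq0 Hr).
by rewrite Ea -catA suffix_infix.
Qed.

Lemma last_stable f s : semistable f s -> exists u r,
  stable f u /\ s = r ++ u.
Proof.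
elim/semistable_ind => [u Hu|a b Ha Hb Sab _ [u [r [Hu Ea]]]].
  by exists u, [::].
by exists u, (a ++ r); rewrite Ea catA.
Qed.

Lemma semistable_sub f x : (forall u, stable f u -> semistable x u) ->
  forall s, semistable f s -> semistable x s.
Proof. by move=> H; apply: semistable_ind => // a b _ _; exact: semistable_cat. Qed.

Lemma stable_cut_gt0 f s a b : stable f s -> s = a ++ b -> a != [::] -> b != [::] ->
  0 < dsign (heading a b) * sm f a.
Proof.
move=> [[_ _ H1] H2] E a0 b0; rewrite lt_neqAle H1// andbT eq_sym mulf_neq0//; last exact: H2 E _ _.
by case: heading; rewrite /dsign ?oppr_eq0 oner_neq0.
Qed.

(** Where two stable segments part, the sign of the common prefix sum dictates the same next step to
    both; if one is a proper prefix of the other, its zero total is a forbidden prefix sum. *)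
Lemma stable_head_inj f s s' : stable f s -> stable f s' ->
  head origin s = head origin s' -> s = s'.
Proof.
move=> Hs Hs' hd; have [c [a [b [Es Es' ne]]]] := common_prefix s s'.
have s0 := semistable_neq0 Hs.1; have s0' := semistable_neq0 Hs'.1.
have c0 : c != [::].
  apply/eqP => c0; subst c; case: a b Es Es' ne => [|v a] [|w b] Es Es' ne;
    try by rewrite ?Es ?Es' in s0 s0'.
  by have := ne v a w b erefl erefl; move: hd; rewrite Es Es' /= => ->; rewrite eqxx.
case: a b Es Es' ne => [|v a] [|w b] Es Es' ne.
- by rewrite Es Es'.
- have [_ + _] := Hs.1; rewrite Es cats0 => /eqP; apply: contraTeq => _.
  exact: Hs'.2 _ _ Es' c0 isT.
- have [_ + _] := Hs'.1; rewrite Es' cats0 => /eqP; apply: contraTeq => _.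
  exact: Hs.2 _ _ Es c0 isT.
have P1 := stable_cut_gt0 Hs Es c0 isT; have P2 := stable_cut_gt0 Hs' Es' c0 isT.
have Sa : sorted step (c ++ v :: a) by rewrite -Es (semistable_sorted Hs.1).
have Sb : sorted step (c ++ w :: b) by rewrite -Es' (semistable_sorted Hs'.1).
have [//|[a' [Ev _]]] := at_right_heading Sa c0 isT.
have [//|[b' [Ew _]]] := at_right_heading Sb c0 isT.
have := ne _ _ _ _ erefl erefl; rewrite -(dsign_gt0_inj P1 P2) in Ew.
by rewrite [X in X != _]Ev [X in _ != X]Ew eqxx.
Qed.

(** Mirror image of [stable_head_inj]: the part before a common suffix [c] has sum [- sm f c], whose
    sign dictates the step into [c]. *)
Lemma stable_last_inj f s s' : stable f s -> stable f s' ->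
  last origin s = last origin s' -> s = s'.
Proof.
move=> Hs Hs' la; have [rc [ra [rb [Es Es' ne]]]] := common_prefix (rev s) (rev s').
have s0 := semistable_neq0 Hs.1; have s0' := semistable_neq0 Hs'.1.
have {}Es : s = rev ra ++ rev rc by rewrite -rev_cat -Es revK.
have {}Es' : s' = rev rb ++ rev rc by rewrite -rev_cat -Es' revK.
have c0 : rev rc != [::].
  apply/eqP => c0; rewrite c0 !cats0 in Es Es'; move: la; rewrite Es Es'.
  case: ra rb Es Es' ne => [|v a] [|w b] Es Es' ne;
    try by rewrite ?Es ?Es' in s0 s0'.
  by rewrite !rev_cons !last_rcons => vw; have := ne v a w b erefl erefl; rewrite vw eqxx.
set c := rev rc in c0 Es Es'.
have sc t k : semistable f t -> t = k ++ c -> sm f k = - sm f c.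
  by move=> [_ + _] Et; rewrite Et sm_cat; lra.
case: ra rb Es Es' ne => [|v a] [|w b] Es Es' ne.
- by rewrite Es Es'.
- have b0 : rev (w :: b) != [::] by rewrite rev_cons -cats1; case: rev.
  have := Hs'.2 _ _ Es' b0 c0; rewrite (sc _ _ Hs'.1 Es') oppr_eq0.
  by have [_ + _] := Hs.1; rewrite Es => ->; rewrite eqxx.
- have a0 : rev (v :: a) != [::] by rewrite rev_cons -cats1; case: rev.
  have := Hs.2 _ _ Es a0 c0; rewrite (sc _ _ Hs.1 Es) oppr_eq0.
  by have [_ + _] := Hs'.1; rewrite Es' => ->; rewrite eqxx.
have a0 : rev (v :: a) != [::] by rewrite rev_cons -cats1; case: rev.
have b0 : rev (w :: b) != [::] by rewrite rev_cons -cats1; case: rev.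
have P1 := stable_cut_gt0 Hs Es a0 c0; have P2 := stable_cut_gt0 Hs' Es' b0 c0.
rewrite (sc _ _ Hs.1 Es) in P1; rewrite (sc _ _ Hs'.1 Es') in P2.
have Sa : sorted step (rev (v :: a) ++ c) by rewrite -Es (semistable_sorted Hs.1).
have Sb : sorted step (rev (w :: b) ++ c) by rewrite -Es' (semistable_sorted Hs'.1).
have [c1|[c' Ea]] := at_right_heading Sa a0 c0; first by rewrite c1 in c0.
have [c1|[c'' Eb]] := at_right_heading Sb b0 c0; first by rewrite c1 in c0.
have := ne _ _ _ _ erefl erefl; rewrite -(dsign_gt0_inj P1 P2) {1}Ea in Eb.
case: Eb => /(congr1 (pv (heading (rev (v :: a)) c))) + _.
by rewrite !pv_nx !rev_cons !last_rcons => ->; rewrite eqxx.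
Qed.

End StableSegments.

(** * The rank of a stability function *)

Section Rank.
Variables (R : realType) (lam : {fset vertex}).
Implicit Types (f x y z : vertex -> R) (s t u r a b : seq vertex) (c v : vertex).

Notation semistable := (semistable lam).
Notation stable := (stable lam).
Notation stables := (stables lam).

Definition finer y x : Prop := forall s, semistable y s -> semistable x s.

Definition rank f : nat := #|` stables f|.

Definition heads f : {fset vertex} := [fset head origin s | s in stables f]%fset.

Lemma card_heads f : #|` heads f| = rank f.
Proof.
by apply: card_in_imfset => s t /in_stables Hs /in_stables Ht; exact: stable_head_inj Hs Ht.
Qed.

(** A [y]-stable segment is [x]-semistable, so it begins with an [x]-stable one. *)
Lemma heads_sub y x : finer y x -> (heads y `<=` heads x)%fset.
Proof.
move=> yx; apply/fsubsetP => v /imfsetP[s /= /in_stables Hs ->].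
have [u [r [Hu E _]]] := first_stable (yx _ Hs.1).
apply/imfsetP; exists u => /=; first exact/in_stables.
by rewrite E; case: (u) (semistable_neq0 Hu.1).
Qed.

Lemma rank_le y x : finer y x -> (rank y <= rank x)%N.
Proof. by move=> /heads_sub/fsubset_leq_card; rewrite !card_heads. Qed.

Lemma sorted_head_lev s v : sorted step s -> v \in behead s -> lev (head origin s) < lev v.
Proof. by case: s => //= w s; exact: lev_lt. Qed.

Lemma stable_finer y x s : finer y x -> stable x s -> semistable y s -> stable y s.
Proof.
move=> yx Hs ys; split=> // a b E a0 b0; apply/eqP => ya.
have xa : semistable x a.
  by apply: yx; apply: (semistable_slice (a := [::]) (b := b) ys) => //; rewrite sm_nil.
by have := Hs.2 _ _ E a0 b0; have [_ -> _] := xa; rewrite eqxx.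
Qed.

(** The sets of heads coincide. Among the [x]-stable segments that are not [y]-semistable, take [s]
    with head of highest level. The [y]-stable segment with that head properly extends [s], and its
    last [x]-stable piece is a counterexample with a higher head, by [stable_last_inj]. *)
Lemma finer_rank_eq y x : finer y x -> (rank x <= rank y)%N -> finer x y.
Proof.
move=> yx le.
have Eh : heads y = heads x.
  by apply/eqP; rewrite eqEfcard (heads_sub yx) !card_heads.
apply: semistable_sub => s0 Hs0; have [//|ns0] := EM (semistable y s0); exfalso.
pose L := [seq s <- stables x | `[< ~ semistable y s >]].
have s0L : s0 \in L by rewrite mem_filter; apply/andP; split; [exact/asboolP|exact/in_stables].
have L0 : L != [::] by apply/eqP => L0; rewrite L0 in s0L.
have [s sL max] := seq_argmin (fun s => - lev (head origin s)) L0.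
move: sL; rewrite mem_filter => /andP[/asboolP nys /in_stables Hs].
have : head origin s \in heads y.
  by rewrite Eh; apply/imfsetP; exists s => //=; exact/in_stables.
case/imfsetP => s' /= /in_stables Hs' hd.
have [u [r [Hu E Hr]]] := first_stable (yx _ Hs'.1).
have Eus : u = s.
  apply: (stable_head_inj Hu Hs); rewrite hd E.
  by case: (u) (semistable_neq0 Hu.1).
subst u; case: Hr => [r0|Hr].
  by apply: nys; rewrite r0 cats0 in E; rewrite -E; exact: Hs'.1.
have [u [r' [Hu' Er]]] := last_stable Hr.
have u0 := semistable_neq0 Hu'.1; have s00 := semistable_neq0 Hs.1.
have [yu|nyu] := EM (semistable y u).
  have Eu : u = s'.
    apply: (stable_last_inj (stable_finer yx Hu' yu) Hs').
    by rewrite E Er !last_cat; case: (u) u0.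
  by have := congr1 size E; rewrite Er Eu !size_cat; case: (s) s00 => //= *; lia.
have uL : u \in L by rewrite mem_filter; apply/andP; split; [exact/asboolP|exact/in_stables].
have := max u uL; rewrite lerN2 leNgt => /negP; apply.
rewrite hd; apply: sorted_head_lev; first exact: semistable_sorted Hs'.1.
rewrite E Er; case: (s) s00 => // v s'' _; rewrite /= !mem_cat.
by case: (u) u0 => // w u' _; rewrite mem_head !orbT.
Qed.

(* The indicator vectors of the stable segments are linearly independent, since
   each has its own lowest-level vertex, the head. *)
Lemma separate_stables f (A : seq (seq vertex)) : (size A < rank f)%N ->
  exists z, (forall a, a \in A -> sm z a = 0) /\
    exists2 s, stable f s & sm z s != 0.
Proof.
set l := enum_fset (stables f) => ltA.
have rl : rank f = size l by [].
have ul : uniq l := fset_uniq _.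
pose vl := enum_fset lam; pose N := size vl.
pose cnt s (k : 'I_N) : R := \sum_(v <- s) (nth origin vl k == v)%:R.
pose M := \matrix_(i < size l, k < N) cnt (nth [::] l i) k.
pose B := \matrix_(i < size A, k < N) cnt (nth [::] A i) k.
have stl i : (i < size l)%N -> stable f (nth [::] l i).
  by move=> il; apply/in_stables; exact: mem_nth.
have freeM : row_free M.
  apply: inj_row_free => c cM; apply/rowP => i0; rewrite mxE.
  apply/eqP; apply/negPn/negP => ci0.
  pose hd (i : 'I_(size l)) := head origin (nth [::] l i).
  have L0 : [seq i <- enum 'I_(size l) | c 0 i != 0] != [::].
    by rewrite -has_filter; apply/hasP; exists i0; rewrite ?mem_enum.
  (* In the column of the lowest head in the support of [c] only row [i] contributes: the other
     heads in the support are different and not lower. *)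
  have [i] := seq_argmin (fun i => lev (hd i)) L0.
  rewrite mem_filter => /andP[ci _] min.
  have Hi := stl i (ltn_ord i); have i_neq0 := semistable_neq0 Hi.1.
  have hdi : hd i \in nth [::] l i by rewrite /hd; case: (nth _ _ _) i_neq0 => // *; exact: mem_head.
  have hdl : hd i \in vl.
    by case: Hi.1 => /and3P[_ /allP/(_ _ hdi)/and5P[]].
  have klt : (index (hd i) vl < N)%N by rewrite index_mem.
  pose k := Ordinal klt.
  have nk : nth origin vl k = hd i by rewrite nth_index.
  have := congr1 (fun m : 'rV_N => m 0 k) cM; rewrite !mxE (bigD1 i) //= big1 => [|j ji].
    rewrite addr0 mxE => /eqP; rewrite mulf_eq0 (negbTE ci) /= /cnt nk.
    have /path.splitPr E := hdi; case: E => p1 p2.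
    rewrite big_cat big_cons eqxx gt_eqF//=.
    have p0 (p : seq vertex) : 0 <= \sum_(v <- p) (hd i == v)%:R :> R by apply: sumr_ge0.
    by have := p0 p1; have := p0 p2; lra.
  rewrite mxE; have [->|cj] := eqVneq (c 0 j) 0; first by rewrite mul0r.
  have Hj := stl j (ltn_ord j).
  rewrite /cnt nk big_seq big1 ?mulr0// => v vj; case: eqP => // Ev; exfalso.
  have levj : lev (hd i) <= lev (hd j).
    by apply: min; rewrite mem_filter cj mem_enum.
  have Sj := semistable_sorted Hj.1.
  have : v = hd j \/ v \in behead (nth [::] l j).
    by move: vj; rewrite /hd; case: (nth [::] l j) => //= w t; rewrite inE => /predU1P.
  case=> [vhj|/(sorted_head_lev Sj)]; last by rewrite -/(hd j) -Ev; move: levj; lia.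
  have /eqP := stable_head_inj Hi Hj (etrans Ev vhj).
  by rewrite nth_uniq ?ltn_ord// => /eqP/val_inj ij; rewrite ij eqxx in ji.
(* By rank, the rows of [M] do not all lie in the row space of [B]; a column of the cokernel of [B]
   detects this and supplies [z]. *)
have nMB : M *m cokermx B != 0.
  apply/eqP => /eqP; rewrite -submxE => /mxrankS; rewrite (eqP freeM).
  by apply/negP; rewrite -ltnNge; apply: leq_ltn_trans (rank_leq_row B) _; rewrite -rl.
have [i [j Kij]] : exists i j, (M *m cokermx B) i j != 0.
  apply: contrapT => H; move/eqP: nMB; apply; apply/matrixP => i j; rewrite [RHS]mxE.
  by apply/eqP; apply/negPn/negP => ?; apply: H; exists i, j.
pose z v := \sum_(k < N) (nth origin vl k == v)%:R * cokermx B k j.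
have Ez s : sm z s = \sum_(k < N) cnt s k * cokermx B k j.
  by rewrite /sm /z exchange_big /=; apply: eq_bigr => k _; rewrite mulr_suml.
exists z; split=> [a aA|]; last first.
  exists (nth [::] l i); first exact: stl (ltn_ord i).
  rewrite Ez; move: Kij; rewrite mxE; congr (_ != _); apply: eq_bigr => k _; by rewrite mxE.
have ia : (index a A < size A)%N by rewrite index_mem.
have := congr1 (fun m : 'M_(size A, N) => m (Ordinal ia) j) (mulmx_coker B).
rewrite !mxE Ez => E0; rewrite -[RHS]E0; apply: eq_bigr => k _.
by rewrite [in RHS]mxE [X in nth _ _ X]/= nth_index.
Qed.

(* Semistability with respect to [x + eps * y] for all small [eps > 0]. *)
Definition semistable_at x y s : Prop := [/\ semistable x s, sm y s = 0 &
  forall a b, s = a ++ b -> a != [::] -> b != [::] -> sm x a = 0 ->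
    0 <= dsign (heading a b) * sm y a].

Lemma small_eps (l : seq (R * R)) : exists2 r : R, 0 < r &
  forall q, q \in l -> q.1 != 0 -> r * `|q.2| < `|q.1|.
Proof.
elim: l => [|q l [r r0 H]]; first by exists 1.
have [q0|q0] := eqVneq q.1 0.
  exists r => // q'; rewrite inE => /predU1P[->|/H//]; by rewrite q0 eqxx.
have q20 : 0 < `|q.2| + 1 by have := normr_ge0 q.2; lra.
have q10 : 0 < `|q.1| by rewrite normr_gt0.
have d0 : 0 < `|q.1| / (`|q.2| + 1) by rewrite divr_gt0.
exists (Num.min r (`|q.1| / (`|q.2| + 1))); first by rewrite lt_min r0.
move=> q'; rewrite inE => /predU1P[-> _|q'l q'0].
  apply: (@le_lt_trans _ _ (`|q.1| / (`|q.2| + 1) * `|q.2|)).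
    by apply: ler_wpM2r => //; rewrite ge_min lexx orbT.
  rewrite mulrAC ltr_pdivrMr// ltr_pM2l//; lra.
by apply: le_lt_trans (H _ q'l q'0); apply: ler_wpM2r => //; rewrite ge_min lexx.
Qed.

(** By [small_eps], [r] is so small that every nonzero [x]-sum of a segment keeps its sign, and [y]
    decides only where the [x]-sum vanishes. *)
Lemma perturb x y : exists f, (exists2 r : R, 0 < r & f = fun v => x v + r * y v) /\
  (forall s, semistable f s <-> semistable_at x y s) /\
  (forall a, is_segment lam a -> sm x a != 0 -> sm f a != 0).
Proof.
have [r r0 H] := small_eps [seq (sm x a, sm y a) | a <- all_seqs lam].
pose f v := x v + r * y v; exists f; split; first by exists r.
have near d a : is_segment lam a -> sm x a != 0 ->
    (sm f a != 0) /\ (0 <= dsign d * sm f a -> 0 <= dsign d * sm x a) /\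
    (0 <= dsign d * sm x a -> 0 <= dsign d * sm f a).
  move=> Sa xa; have /H := map_f (fun a => (sm x a, sm y a)) (segment_all_seqs Sa).
  move=> /(_ xa) /=; rewrite smD => lt.
  have : `|r * sm y a| < `|sm x a| by rewrite normrM (gtr0_norm r0).
  rewrite ltr_norml; have [x0|x0] := ltrP 0 (sm x a).
    rewrite (gtr0_norm x0) => /andP[l1 l2]; split; first by rewrite gt_eqF//; lra.
    by rewrite /dsign; case: d; split; lra.
  have {}x0 : sm x a < 0 by rewrite lt_neqAle xa.
  rewrite (ltr0_norm x0) => /andP[l1 l2]; split; first by rewrite lt_eqF//; lra.
  by rewrite /dsign; case: d; split; lra.
split=> [s|a Sa xa]; last by have [] := near true a Sa xa.
have seg a b : is_segment lam s -> s = a ++ b -> a != [::] -> is_segment lam a.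
  by move=> Ss E a0; apply: segment_infix Ss _ a0; rewrite E prefix_infix.
split=> [[Ss fs Hf]|[[Ss xs Hx] ys Hy]]; last first.
  split=> // [|a b E a0 b0]; first by rewrite smD xs ys mulr0 addr0.
  have [xa|xa] := eqVneq (sm x a) 0; last first.
    by have [_ [_ H']] := near (heading a b) a (seg _ _ Ss E a0) xa; apply: H'; exact: Hx.
  rewrite smD xa add0r mulrCA; apply: mulr_ge0; first exact: ltW.
  exact: Hy.
have xs : sm x s = 0.
  apply/eqP; apply/negPn/negP => xs; have [] := near true s Ss xs.
  by rewrite fs eqxx.
split=> // [||a b E a0 b0 xa].
- split=> // a b E a0 b0.
  have [->|xa] := eqVneq (sm x a) 0; first by rewrite mulr0.
  by have [_ [H' _]] := near (heading a b) a (seg _ _ Ss E a0) xa; apply: H'; exact: Hf.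
- move: fs; rewrite smD xs add0r => /eqP; rewrite mulf_eq0 gt_eqF//= => /eqP//.
have := Hf _ _ E a0 b0; rewrite smD xa add0r mulrCA.
by rewrite pmulr_rge0.
Qed.

(** * Generic points of intersections of shards *)

Definition contains (I : set (seq vertex)) x := forall s, I s -> semistable x s.

Lemma min_rank I : (forall s, I s -> is_segment lam s) -> exists x, contains I x /\
  forall y, contains I y -> (rank x <= rank y)%N.
Proof.
move=> SI; pose P n := `[< exists x, contains I x /\ rank x = n >].
have exP : exists n, P n.
  exists (rank (fun=> 0)); apply/asboolP; exists (fun=> 0); split=> // s /SI Ss.
  have s0 t : sm (fun=> 0 : R) t = 0 by rewrite /sm big1.
  by split=> // a b _ _ _; rewrite s0 mulr0.
case: (ex_minnP exP) => n /asboolP[x [Ix <-]] min; exists x; split=> // y Iy.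
by apply: min; apply/asboolP; exists y.
Qed.

Lemma sm_semistable0 x z s : (forall u, stable x u -> infix u s -> sm z u = 0) ->
  semistable x s -> sm z s = 0.
Proof.
move=> H Hs; move: H; elim/semistable_ind: s / Hs => [u Hu|a b _ _ _ IHa IHb] H.
  by apply: H => //; exact: infix_refl.
rewrite sm_cat IHa ?IHb ?addr0// => u Hu I; apply: H => //.
  exact: infix_trans I (suffix_infix _ _).
exact: infix_trans I (prefix_infix _ _).
Qed.

(** Apply [separate_stables] to the other stable segments, one fewer than the rank; the segment it
    detects must be [s]. *)
Lemma dual_stable x s : stable x s -> exists2 z : vertex -> R,
  (forall u, stable x u -> u != s -> sm z u = 0) & sm z s != 0.
Proof.
move=> Hs; have [|z [z0 [t Ht zt]]] := @separate_stables x (rem s (enum_fset (stables x))).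
  have sl : s \in enum_fset (stables x) by exact/in_stables.
  rewrite size_rem// (_ : rank x = size (enum_fset (stables x)))//.
  by case: (enum_fset _) sl.
have zst u : stable x u -> u != s -> sm z u = 0.
  move=> Hu us; apply: z0; rewrite (rem_filter _ (fset_uniq _)) mem_filter /= us.
  exact/in_stables.
exists z => //; suff <- : t = s by [].
by apply/eqP; apply/negPn/negP => /(zst t Ht)/eqP; rewrite (negbTE zt).
Qed.

(** Take [x] of least rank. A perturbation keeping [I] semistable cannot lower the rank, so its
    direction vanishes on all [x]-semistable segments. Hence every [x]-stable segment occurs after a
    zero cut in a member of [I], and [y] has zero sums there too. *)
Lemma generic_point I : (forall s, I s -> is_segment lam s) ->
  exists x, forall y, contains I y <-> finer x y.
Proof.
move=> SI; have [x [Ix min]] := min_rank SI; exists x => y; split; last by move=> xy s /Ix/xy.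
have stay z : contains I z \/ (forall i, I i -> semistable_at x z i) ->
    forall s, semistable x s -> sm z s = 0.
  move=> Hz; have [f [_ [Hf _]]] := perturb x z.
  have If : contains I f.
    move=> i Ii; apply/Hf; case: Hz => [Iz|]; last exact.
    by have [Si zi Hzi] := Iz i Ii; split=> //; [exact: Ix|move=> a b E a0 b0 _; exact: Hzi].
  have fx : finer f x by move=> s /Hf[].
  by move=> s /(finer_rank_eq fx (min f If))/Hf[].
move=> Iy; have y0 := stay y (or_introl Iy).
apply: semistable_sub => s Hs.
pose occurs i := exists a b, i = a ++ s ++ b /\ sm x a = 0.
have [[i [Ii [a [b [E xa]]]]]|none] := EM (exists i, I i /\ occurs i).
  apply: (semistable_slice (Iy i Ii) E (semistable_neq0 Hs.1)).
    have [->|a0] := eqVneq a [::]; first by rewrite sm_nil.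
    by apply/y0/(semistable_slice (a := [::]) (b := s ++ b) (Ix i Ii)); rewrite ?sm_nil.
  exact: y0 Hs.1.
(* A direction dual to an [s] that does not occur would vanish on [I] and at all its [x]-zero cuts,
   though not on [s]. *)
exfalso; have [z zst zt] := dual_stable Hs.
have kill i : semistable x i -> ~ occurs i -> sm z i = 0.
  move=> Hi; elim/semistable_ind: i / Hi => [u Hu no|p q Hp Hq _ IHp IHq no].
    apply: zst => //; apply/eqP => us; apply: no; exists [::], [::].
    by rewrite cats0 us sm_nil.
  rewrite sm_cat IHp ?IHq ?addr0// => -[a [b [E xa]]]; apply: no.
    by exists (p ++ a), b; rewrite E !catA sm_cat xa addr0; case: Hp.
  by exists a, (b ++ q); rewrite E -!catA.
move: zt; rewrite (stay z _ s Hs.1) ?eqxx//; right=> i Ii.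
have Hi := Ix i Ii; split=> //.
  by apply: kill => // oc; apply: none; exists i.
move=> a b E a0 b0 xa; rewrite kill ?mulr0//.
  by apply: (semistable_slice (a := [::]) (b := b) Hi) => //; rewrite sm_nil.
move=> [a' [b' [E' xa']]]; apply: none; exists i; split=> //; exists a', (b' ++ b).
by rewrite E E' -!catA.
Qed.

(** * Lowering the rank by one *)

Lemma prefix_semistable x s a b : semistable x s -> s = a ++ b -> a != [::] ->
  sm x a = 0 -> semistable x a.
Proof.
by move=> Hs E a0; apply: (semistable_slice (a := [::]) (b := b) Hs); rewrite ?sm_nil.
Qed.

(** Perturbing [x] in a direction dual to [s0] loses [s0] and keeps all other stable segments
    stable. *)
Lemma drop_stable x s0 : stable x s0 -> exists g, [/\ finer g x, (rank g).+1 = rank x &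
  forall u, stable x u -> u != s0 -> semistable g u].
Proof.
move=> Hs0; have [z z0 zs0] := dual_stable Hs0.
have [g [_ [Hg gcut]]] := perturb x z.
have stg u : stable x u -> u != s0 -> stable g u.
  move=> Hu us; split.
    apply/Hg; split; [exact: Hu.1|exact: z0|move=> a b E a0 b0 xa].
    by have := Hu.2 _ _ E a0 b0; rewrite xa eqxx.
  move=> a b E a0 b0; apply: gcut; last exact: Hu.2 E a0 b0.
  by case: Hu.1 => Su _ _; apply: segment_infix Su _ a0; rewrite E prefix_infix.
have gx : finer g x by move=> s /Hg[].
exists g; split=> // [|u Hu us]; last by case: (stg u Hu us).
apply/eqP; rewrite eqn_leq; apply/andP; split.
  rewrite ltnNge; apply/negP => /(finer_rank_eq gx)/(_ _ Hs0.1)/Hg[_ /eqP].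
  by rewrite (negbTE zs0).
have s0in : s0 \in stables x by exact/in_stables.
rewrite /rank (cardfsD1 s0 (stables x)) s0in add1n ltnS.
apply: fsubset_leq_card; apply/fsubsetP => u; rewrite !in_fsetD1 => /andP[us /in_stables Hu].
by apply/in_stables; exact: stg.
Qed.

(** Perturb [x] in a direction [y] that keeps the [x']-semistable segments. If the rank falls by
    more than one, drop a single stable segment or pass to a direction that keeps strictly more; [n]
    bounds the number of such improvements. *)
Lemma rank_between x' x : finer x' x -> ~ finer x x' ->
  exists g, [/\ finer x' g, finer g x & (rank g).+1 = rank x].
Proof.
move=> x'x nx.
suff main n : forall y, (forall s, semistable x' s -> semistable_at x y s) ->
    (exists2 s, stable x s & sm y s != 0) ->
    (forall f, (forall s, semistable f s <-> semistable_at x y s) -> rank x <= rank f + n)%N ->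
    exists g, [/\ finer x' g, finer g x & (rank g).+1 = rank x].
  have ltx : (rank x' < rank x)%N.
    by rewrite ltnNge; apply/negP => /(finer_rank_eq x'x).
  (* Start from [x'], tilted slightly by [z] if it vanishes on the separated segment. *)
  have [y x'y exs] : exists2 y, finer x' y & exists2 s, stable x s & sm y s != 0.
    have [z [z0 [s Hs zs]]] := @separate_stables x (enum_fset (stables x')) ltx.
    have [x's|x's] := eqVneq (sm x' s) 0; last by exists x' => //; exists s.
    have [f [[r r0 Ef] [Hf _]]] := perturb x' z; exists f.
      apply: semistable_sub => u Hu; apply/Hf; split; [exact: Hu.1|exact/z0/in_stables|].
      by move=> a b E a0 b0 xa; have := Hu.2 _ _ E a0 b0; rewrite xa eqxx.
    by exists s => //; rewrite Ef smD x's add0r mulf_neq0// gt_eqF.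
  apply: (main (rank x) y) => // [s Hs|f _]; last exact: leq_addl.
  have [_ ys Hy] := x'y s Hs; split=> //; first exact: x'x.
  by move=> a b E a0 b0 _; exact: Hy.
elim: n => [|n IH] y Hy [s0 Hs0 ys0] Hn; have [f [[r r0 Ef] [Hf fcut]]] := perturb x y.
  have := Hn f Hf; rewrite addn0 => le.
  have fx : finer f x by move=> s /Hf[].
  have /Hf[_ /eqP] := finer_rank_eq fx le Hs0.1.
  by rewrite (negbTE ys0).
have fx : finer f x by move=> s /Hf[].
have lt : (rank f < rank x)%N.
  rewrite ltnNge; apply/negP => /(finer_rank_eq fx)/(_ _ Hs0.1)/Hf[_ /eqP].
  by rewrite (negbTE ys0).
have x'f : finer x' f by move=> s /Hy/Hf.
have [E|ne] := eqVneq (rank f).+1 (rank x); first by exists f.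
have {ne}lt : ((rank f).+1 < rank x)%N by rewrite ltn_neqAle ne.
have [[w0 [a0 [b0 [Hw0 Ew0 a00 b00 xa0]]]]|none] := EM (exists w a b,
    [/\ stable f w, w = a ++ b, a != [::], b != [::] & sm x a = 0]); last first.
  (* Here all [f]-stable segments are [x]-stable and differ from [s0], so dropping [s0] alone keeps
     them. *)
  have fstx u : stable f u -> stable x u.
    move=> Hu; split; first exact/fx/Hu.1.
    by move=> a b E a0 b0; apply/eqP => xa; apply: none; exists u, a, b.
  have [g [gx rg Hg]] := drop_stable Hs0; exists g; split=> //.
  move=> s /x'f; move: s; apply: semistable_sub => u Hu.
  apply: Hg; first exact: fstx.
  apply/eqP => us; have /Hf[_ /eqP] := Hu.1; by rewrite us (negbTE ys0).
(* A fall in rank by at least two leaves room for [a0] beside the [f]-stable segments. *)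
have [|u [u0 [s1 Hs1 us1]]] := @separate_stables x (a0 :: enum_fset (stables f)); first by [].
have ua0 : sm u a0 = 0 by apply: u0; exact: mem_head.
have ust w : stable f w -> sm u w = 0.
  by move=> Hw; apply: u0; rewrite inE; apply/orP; right; exact/in_stables.
pose Q (q : seq vertex * seq vertex) :=
  [/\ stable f (q.1 ++ q.2), q.1 != [::], q.2 != [::] & sm x q.1 = 0].
pose L := [seq q <- [seq (a, b) | a <- all_seqs lam, b <- all_seqs lam] | `[< Q q >]].
have inL q : Q q -> q \in L.
  case: q => a b /[dup] Hq [[[S _ _] _] /= a1 b1 _]; rewrite mem_filter; apply/andP; split.
    exact/asboolP.
  have [Sa Sb] := segment_cat S; apply/allpairsP; exists (a, b).
  by split=> //=; apply: segment_all_seqs; auto.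
have LQ q : q \in L -> Q q by rewrite mem_filter => /andP[/asboolP].
pose A q := dsign (heading q.1 q.2) * sm y q.1; pose B q := dsign (heading q.1 q.2) * sm u q.1.
have Apos q : Q q -> 0 < A q.
  move=> [Hq a1 b1 xa]; have := stable_cut_gt0 Hq erefl a1 b1.
  by rewrite Ef smD xa add0r mulrCA pmulr_rgt0.
have Q0 : Q (a0, b0) by split=> //=; rewrite -Ew0.
have L0 : L != [::] by apply/eqP => L0; have := inL _ Q0; rewrite L0.
(* The least ratio [m] is the largest multiple for which [u - m * y] keeps the required sign at
   every cut in [Q]; at [qm] it vanishes. *)
have [qm qmL min] := seq_argmin (fun q => B q / A q) L0.
set m := B qm / A qm in min; have Qm := LQ _ qmL.
pose y2 v := u v + (- m) * y v.
have Ey2 s : sm y2 s = sm u s - m * sm y s by rewrite smD mulNr.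
have ge q : Q q -> 0 <= dsign (heading q.1 q.2) * sm y2 q.1.
  move=> Hq; rewrite Ey2 mulrBr mulrCA -/(A q) -/(B q) subr_ge0.
  by rewrite -ler_pdivlMr ?Apos//; exact/min/inL.
have zero : sm y2 qm.1 = 0.
  have : dsign (heading qm.1 qm.2) * sm y2 qm.1 = 0.
    by rewrite Ey2 mulrBr mulrCA -/(A qm) -/(B qm) /m divfK ?subrr// gt_eqF// Apos.
  by move/eqP; rewrite mulf_eq0 => /orP[|/eqP//]; case: heading; rewrite /dsign ?oppr_eq0 oner_eq0.
(* Otherwise [y2] vanishes on [a0], where [u] is zero and [y] is not; so [m] is 0 and [y2] agrees
   with [u], which is nonzero on [s1]. *)
have ex2 : exists2 s, stable x s & sm y2 s != 0.
  apply: contrapT => none.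
  have y20 s : stable x s -> sm y2 s = 0.
    by move=> Hs; apply/eqP; apply/negPn/negP => ?; apply: none; exists s.
  have := sm_semistable0 (fun (w : seq vertex) Hw _ => y20 w Hw) (prefix_semistable (fx _ Hw0.1) Ew0 a00 xa0).
  rewrite Ey2 ua0 sub0r => /eqP; rewrite oppr_eq0 mulf_eq0 => /orP[/eqP m0|/eqP ya0].
    by have := y20 s1 Hs1; rewrite Ey2 m0 mul0r subr0 => /eqP; rewrite (negbTE us1).
  by have := Apos _ Q0; rewrite /A /= ya0 mulr0 ltxx.
have f2 s : semistable f s -> semistable_at x y2 s.
  have [g [_ [Hg _]]] := perturb x y2.
  move=> Hs; apply/Hg; move: s Hs; apply: semistable_sub => w Hw; apply/Hg.
  have /Hf[xw yw _] := Hw.1; split=> //; first by rewrite Ey2 ust// yw mulr0 subrr.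
  by move=> a b E a1 b1 xa; apply: (ge (a, b)); split=> //=; rewrite -E.
apply: (IH y2) => // [s /x'f/f2//|g Hg].
have fg : finer f g by move=> s /f2/Hg.
(* The prefix [qm.1] of an [f]-stable segment becomes semistable for [g], so the rank rises
   strictly. *)
suff : (rank f < rank g)%N by have := Hn f Hf; lia.
rewrite ltnNge; apply/negP => /(finer_rank_eq fg) gf.
have [Hq a1 b1 xa] := Qm.
have /gf[_ fa _] : semistable g qm.1.
  apply/Hg; split; [|exact: zero|].
    exact: prefix_semistable (fx _ Hq.1) erefl a1 xa.
  move=> a b E a2 b2 xa'; have := ge (a, b ++ qm.2).
  rewrite -(@heading_cat a b [::] qm.2 a2 b2) /=.
  apply; split=> //=; first by rewrite catA -E.
  by case: (b) b2.
by have := Hq.2 _ _ erefl a1 b1; rewrite fa eqxx.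
Qed.

End Rank.

Local Open Scope classical_set_scope.
Local Open Scope card_scope.

(** * Posets with a rank function *)

Section GradedByRank.
Context {d : Order.disp_t} {T : porderType d}.
Variables (rk : T -> nat) (bot top : T).
Hypothesis bot_le : forall x, (bot <= x)%O.
Hypothesis le_top : forall x, (x <= top)%O.
Hypothesis rk_lt : forall x y, (x < y)%O -> (rk x < rk y)%N.
Hypothesis rk_pred : forall x y, (x < y)%O ->
  exists z, [/\ (x <= z)%O, (z < y)%O & (rk z).+1 = rk y].

Lemma rk_le x y : (x <= y)%O -> (rk x <= rk y)%N.
Proof. by rewrite le_eqVlt => /predU1P[->//|/rk_lt/ltnW]. Qed.

Lemma rk_interpolate x y n : (x < y)%O -> (rk x <= n <= rk y)%N ->
  exists z, [/\ (x <= z)%O, (z <= y)%O & rk z = n].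
Proof.
have [k] := ubnP (rk y - n); elim: k y => // k IH y le xy /andP[xn].
rewrite leq_eqVlt => /predU1P[->|ny]; first by exists y; rewrite lexx ltW.
have [z [xz zy rz]] := rk_pred xy.
move: xz; rewrite le_eqVlt => /predU1P[xz|xz].
  by exists x; rewrite lexx ltW//; split=> //; rewrite xz in xn *; lia.
have [|| w [xw wz rw]] := IH z _ xz; [lia|by rewrite xn; lia|].
by exists w; rewrite xw (le_trans wz (ltW zy)).
Qed.

Lemma maximal_chain_mem C x : maximal_chain T C ->
  (forall y, C y -> (x <= y)%O || (y <= x)%O) -> C x.
Proof.
move=> [chC maxC] cmp; have <- : C `|` [set x] = C; last by right.
apply: maxC; last by move=> y; left.
move=> y z [Cy|->] [Cz|->].
- exact: chC.
- by have /orP[] := cmp y Cy; [right|left].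
- by have /orP[] := cmp z Cz; [left|right].
- by left.
Qed.

(** If rank [n] were missed, an element of rank [n] between the nearest members of the chain below
    and above would be comparable with the whole chain. *)
Lemma maximal_chain_rk C : maximal_chain T C ->
  rk @` C = [set n | (rk bot <= n <= rk top)%N].
Proof.
move=> mC; have chC := mC.1.
have Cbot : C bot by apply: maximal_chain_mem mC _ => y _; rewrite bot_le.
have Ctop : C top by apply: maximal_chain_mem mC _ => y _; rewrite le_top orbT.
apply/seteqP; split=> [_ [x _ <-]|n /= /andP[bn nt]]; first by rewrite /= !rk_le.
apply: contrapT => none.
have neq x : C x -> rk x != n by move=> Cx; apply/eqP => E; apply: none; exists x.
have [y [Cy ny miny]] : exists y, [/\ C y, (n < rk y)%N &
    forall z, C z -> (n < rk z)%N -> (rk y <= rk z)%N].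
  pose P m := `[< exists y, [/\ C y, (n < rk y)%N & rk y = m] >].
  have exP : exists m, P m.
    by exists (rk top); apply/asboolP; exists top; split=> //; rewrite ltn_neqAle eq_sym neq.
  case: (ex_minnP exP) => m /asboolP[y [Cy ny <-]] min; exists y; split=> // z Cz nz.
  by apply: min; apply/asboolP; exists z.
have [x [Cx xn maxx]] : exists x, [/\ C x, (rk x < n)%N &
    forall z, C z -> (rk z < n)%N -> (rk z <= rk x)%N].
  pose P m := `[< exists y, [/\ C y, (rk y < n)%N & rk y = m] >].
  have exP : exists m, P m.
    by exists (rk bot); apply/asboolP; exists bot; split=> //; rewrite ltn_neqAle neq.
  have ubP m : P m -> (m <= n)%N by move=> /asboolP[z [_ /ltnW + <-]].
  case: (ex_maxnP exP ubP) => m /asboolP[y' [Cy' ny' <-]] max; exists y'; split=> // z Cz nz.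
  by apply: max; apply/asboolP; exists z.
have below u v : C u -> C v -> (rk u <= rk v)%N -> (u <= v)%O.
  move=> Cu Cv uv; have [//|] := chC u v Cu Cv.
  by rewrite le_eqVlt => /predU1P[->//|/rk_lt]; rewrite ltnNge uv.
have xy : (x < y)%O.
  rewrite lt_neqAle below// ?andbT; last by lia.
  by apply/eqP => E; move: xn ny; rewrite E; lia.
have [|z [xz zy rz]] := rk_interpolate (n := n) xy; first by lia.
apply: none; exists z => //; apply: maximal_chain_mem mC _ => u Cu.
have := neq u Cu; rewrite neq_ltn => /orP[un|nu].
  by rewrite (le_trans (below _ _ Cu Cx (maxx u Cu un)) xz) orbT.
by rewrite (le_trans zy (below _ _ Cy Cu (miny u Cu nu))).
Qed.

(** Strict monotonicity makes [rk] injective on chains, so all maximal chains biject with the same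
    interval of ranks. *)
Lemma graded_by_rank : finite_set [set: T] -> is_graded T.
Proof.
move=> fin; split=> //; first by exists bot.
  by exists top.
have E C : maximal_chain T C -> C #= [set n | (rk bot <= n <= rk top)%N].
  move=> mC; rewrite card_eq_sym -(maximal_chain_rk mC); apply: inj_card_eq.
  move=> x y /set_mem Cx /set_mem Cy rxy.
  have [|] := mC.1 x y Cx Cy; rewrite le_eqVlt => /predU1P[->//|/rk_lt];
    by rewrite rxy ltnn.
by move=> C D /E CE /E DE; apply: card_eq_trans CE _; rewrite card_eq_sym.
Qed.

End GradedByRank.

(** * The shard intersection order *)

Section ShardOrderRank.
Variables (R : realType) (lam : {fset vertex}).
Implicit Types (X Y Z : shard_order R lam) (x y : {ffun interior_set lam -> R}).
Implicit Types (f g : vertex -> R).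

Notation shard_order := (shard_order R lam).

Definition vec f : {ffun interior_set lam -> R} := [ffun w => f (val w)].

Lemma ev_vec f s : semistable lam (ev (vec f)) s <-> semistable lam f s.
Proof.
have E : {in interior_vertex lam, ev (vec f) =1 f}.
  move=> v iv; have vI : v \in interior_set lam by rewrite interior_setE; exact: iv.
  by rewrite -[v]/(val (Sub v vI : interior_set lam)) ev_val ffunE.
by split; apply: semistable_eq => v /E.
Qed.

Lemma shard_leE X Y : (X <= Y)%O <-> (val Y `<=` val X).
Proof. by split=> [/asboolP|H]; [|apply/asboolP]. Qed.

Lemma shard_segments X : exists I : set (seq vertex),
  (forall s, I s -> is_segment lam s) /\ forall y, val X y <-> contains lam I (ev y).
Proof.
have [I SI E] : shard_intersections R lam (val X) by exact/set_mem/(valP X).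
exists I; split=> // y; rewrite E; split=> H s Is.
  by apply/shardP; [exact: SI|exact: H].
by apply/shardP; [exact: SI|exact: H].
Qed.

Lemma shard_generic X : exists f, forall y, val X y <-> finer lam f (ev y).
Proof.
have [I [SI E]] := shard_segments X; have [f Hf] := generic_point R SI; exists f => y.
by rewrite E Hf.
Qed.

Lemma shard_of_segments (I : set (seq vertex)) : (forall s, I s -> is_segment lam s) ->
  exists Z, forall y, val Z y <-> contains lam I (ev y).
Proof.
move=> SI; have H : \bigcap_(s in I) shard R lam s \in shard_intersections R lam.
  by apply/mem_set; exists I.
exists (exist (fun A => A \in shard_intersections R lam) _ H) => y /=; split=> HI s Is.
  by apply/shardP; [exact: SI|exact: HI].
by apply/shardP; [exact: SI|exact: HI].
Qed.

Definition generic X : vertex -> R := projT1 (cid (shard_generic X)).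

Lemma genericE X y : val X y <-> finer lam (generic X) (ev y).
Proof. exact: projT2 (cid (shard_generic X)) y. Qed.

(** [generic X] itself lies in [X], so reverse inclusion becomes inclusion of sets of semistable
    segments. *)
Lemma shard_le_generic X Y : (X <= Y)%O <-> finer lam (generic X) (generic Y).
Proof.
rewrite shard_leE; split=> [H s Xs|H y /genericE Yy]; last first.
  by apply/genericE => s /H/Yy.
apply/ev_vec; move: s Xs; apply/genericE/H/genericE => s.
by move/ev_vec.
Qed.

(** Take the intersection of the shards of all [f]-semistable segments. *)
Lemma shard_of_generic f : exists Z, finer lam (generic Z) f /\ finer lam f (generic Z).
Proof.
have [|Z HZ] := @shard_of_segments (semistable lam f); first by move=> s [].
exists Z; split=> s.
  move=> Zs; apply/ev_vec; move: s Zs; apply/genericE/HZ => s.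
  by move/ev_vec.
move=> fs; apply/ev_vec; apply: (iffLR (HZ _)) fs.
by apply/genericE => t /ev_vec.
Qed.

(** An element is determined by the semistable segments of its generic point, a subset of a finite
    set. *)
Lemma shard_order_finite : finite_set [set: shard_order].
Proof.
pose F X := [fset s | s in all_seqs lam & `[< semistable lam (generic X) s >]]%fset.
have FE X s : s \in F X <-> semistable lam (generic X) s.
  rewrite !inE; split=> [/andP[_ /asboolP]//|H]; apply/andP; split; last exact/asboolP.
  by case: H => /segment_all_seqs.
have injF : injective F.
  move=> X Y E; apply/le_anti/andP.
  by split; apply/shard_le_generic => s /FE Hs; apply/FE; [rewrite -E|rewrite E].
have : finite_set (F @` [set: shard_order]).
  apply: (sub_finite_set (B := [set` fpowerset [fset s | s in all_seqs lam]%fset])); last exact: finite_fset.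
  move=> _ [X _ <-] /=; rewrite fpowersetE; apply/fsubsetP => s; by rewrite !inE => /andP[].
by rewrite (eq_finite_set (inj_card_eq _))// => X Y _ _; exact: injF.
Qed.

Lemma shard_order_lattice : is_lattice shard_order.
Proof.
move=> X Y; split.
  (* The meet is the intersection of all shards that contain both sets. *)
  pose I s := is_segment lam s /\ forall y, val X y \/ val Y y -> shard R lam s y.
  have [|Z HZ] := @shard_of_segments I; first by move=> s [].
  exists Z; split.
  - apply/shard_leE => y Xy; apply/HZ => s [Ss Hs]; apply/shardP => //.
    by apply: Hs; left.
  - apply/shard_leE => y Yy; apply/HZ => s [Ss Hs]; apply/shardP => //.
    by apply: Hs; right.
  move=> W /shard_leE XW /shard_leE YW; apply/shard_leE => y /HZ Zy.
  have [J [SJ HJ]] := shard_segments W; apply/HJ => s Js; apply: Zy; split; first exact: SJ.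
  move=> z XYz; have Wz : val W z by case: XYz => [/XW|/YW].
  by apply/shardP; [exact: SJ|exact: (iffLR (HJ z) Wz)].
have [I [SI HI]] := shard_segments X; have [J [SJ HJ]] := shard_segments Y.
(* The join is the intersection of the two sets. *)
have [|Z HZ] := @shard_of_segments (I `|` J); first by move=> s [/SI|/SJ].
exists Z; split.
- by apply/shard_leE => y /HZ Zy; apply/HI => s Is; apply: Zy; left.
- by apply/shard_leE => y /HZ Zy; apply/HJ => s Js; apply: Zy; right.
move=> W /shard_leE XW /shard_leE YW; apply/shard_leE => y Wy; apply/HZ => s [].
  by have /HI := XW y Wy; exact.
by have /HJ := YW y Wy; exact.
Qed.

Lemma shard_order_graded : is_graded shard_order.
Proof.
(* The bottom is the whole space, the top the intersection of all shards. *)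
have [|bot Hbot] := @shard_of_segments set0; first by move=> s [].
have [|top Htop] := @shard_of_segments (is_segment lam); first by [].
apply: (@graded_by_rank _ _ (fun X => rank lam (generic X)) bot top).
- by move=> X; apply/shard_leE => y _; apply/Hbot => s [].
- move=> X; apply/shard_leE => y /Htop Hy; have [I [SI HI]] := shard_segments X.
  by apply/HI => s /SI/Hy.
- move=> X Y; rewrite lt_leAnge => /andP[/shard_le_generic XY /negP nYX].
  rewrite ltnNge; apply/negP => /(finer_rank_eq XY)/shard_le_generic; exact: nYX.
- move=> X Y; rewrite lt_leAnge => /andP[/shard_le_generic XY /negP nYX].
  have [|g [Xg gY rg]] := rank_between XY; first by move/shard_le_generic; exact: nYX.
  have [Z [Zg gZ]] := shard_of_generic g; exists Z.
  have rZ : (rank lam (generic Z)).+1 = rank lam (generic Y).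
    by rewrite -rg; congr S; apply/eqP; rewrite eqn_leq !rank_le.
  have XZ : (X <= Z)%O by apply/shard_le_generic => s /Xg/gZ.
  have ZY : (Z <= Y)%O by apply/shard_le_generic => s /Zg/gY.
  split=> //; rewrite lt_neqAle ZY andbT; apply/eqP => E; move: rZ; rewrite E; lia.
exact: shard_order_finite.
Qed.

End ShardOrderRank.

Theorem proposition5p20 (R : realType) (lam : {fset vertex}) :
  is_lattice (shard_order R lam) /\ is_graded (shard_order R lam).
Proof. by split; [exact: shard_order_lattice|exact: shard_order_graded]. Qed.
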